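(* The following four statements are equivalent. (1) For every $n\ge 1$ and every homogeneous Hessian nilpotent polynomial $P(z)\in\mathbb{C}[z_1,\dots,z_n]$ of degree $d=4$, the vanishing property holds for $P$. (2) For every $n\ge 1$, every $d\ge 2$ and every homogeneous Hessian nilpotent polynomial $P(z)\in\mathbb{C}[z_1,\dots,z_n]$ of degree $d$, the vanishing property holds for $P$. (3) For every $n\ge 1$, every $d\geq 2$ and every (not necessarily homogeneous) Hessian nilpotent polynomial $P(z)\in\mathbb{C}[z_1,\dots,z_n]$ of degree $d$ with $o(P(z))\ge 2$, the vanishing property holds for $P$. (4) (Jacobian conjecture) For every $n\ge 1$ and every polynomial map $F(z)=z-H(z)$ from $\mathbb{C}^n$ to $\mathbb{C}^n$ with $o(H(z))\ge 2$ and Jacobian determinant $j(F)(z)=1$ identically, the formal inverse map $G(z)$ of $F(z)$ is a polynomial map.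
   Context: Here $z=(z_1,\dots,z_n)$ and $\Delta=\sum_{i=1}^n \partial^2/\partial z_i^2$. The order $o(U)$ of a power series (or of a vector of power series: the minimum over components) is the lowest degree in $z$ of a monomial occurring. $P$ is Hessian nilpotent (HN) if its Hessian matrix $\left(\frac{\partial^2 P}{\partial z_i\partial z_j}\right)$ is nilpotent. For $P(z)\in\mathbb{C}[[z]]$ with $o(P)\ge 2$ and $t$ a formal parameter, the deformed inversion pair of $P$ is the unique $Q_t(z)\in\mathbb{C}[[z,t]]$ with order $\ge 2$ in $z$ such that $z+t\nabla Q_t(z)$ is the formal (compositional, in $z$) inverse of $z-t\nabla P(z)$. ''The vanishing property holds for $P$'' means: the deformed inversion pair $Q_t(z)$ of $P$ is a polynomial in both $t$ and $z$; more precisely, there is $k_0$ such that $\Delta^k P^{k+1}=0$ for all $k\ge k_0$. *)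

(* Defs.v *)
From HB Require Import structures.
From mathcomp Require Import all_boot all_order all_algebra.
From mathcomp Require Import mpoly complex.
From mathcomp Require Import reals.

Set Implicit Arguments.
Unset Strict Implicit.
Unset Printing Implicit Defensive.

Import Order.TTheory GRing.Theory Num.Theory.
Local Open Scope ring_scope.

Section FormalPowerSeries.
Variable K : comNzRingType.

(* K[[x_0, ..., x_(n-1)]]: a series is the function giving its coefficients,
   and equality of series is extensional equality [=1]. *)
Definition fps (n : nat) : Type := 'X_{1..n} -> K.

Definition fps_of_mpoly n (p : {mpoly K[n]}) : fps n := fun m => p@_m.

Definition fps_polynomial n (f : fps n) : Prop :=
  exists p : {mpoly K[n]}, f =1 fps_of_mpoly p.

(* o(f) >= k; the zero series has infinite order. *)
Definition fps_order_ge n (k : nat) (f : fps n) : Prop :=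
  forall m, f m != 0 -> (k <= mdeg m)%N.

Definition fps_add n (f g : fps n) : fps n := fun m => f m + g m.

(* Cauchy product, in the format of [mcoeffM]. *)
Definition fps_mul n (f g : fps n) : fps n := fun m =>
  \sum_(k : 'X_{1..n < (mdeg m).+1, (mdeg m).+1} | m == (k.1 + k.2)%MM)
    f k.1 * g k.2.

(* Partial derivative, in the format of [mcoeff_deriv]. *)
Definition fps_deriv n (i : 'I_n) (f : fps n) : fps n := fun m =>
  f (m + U_(i))%MM *+ (m i).+1.

(* The part of [f] of total degree < d. *)
Definition fps_trunc n (d : nat) (f : fps n) : {mpoly K[n]} :=
  \sum_(m : 'X_{1..n < d}) f m *: 'X_[m].

(* Substitution f(g_0, ..., g_(k-1)), for g_i WITHOUT CONSTANT TERM: then terms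
   of degree > mdeg m, in [f] or in the [g i], cannot contribute to the
   coefficient of 'X_[m]. It is meaningless if some [g i] has a constant term. *)
Definition fps_comp k n (f : fps k) (g : 'I_k -> fps n) : fps n := fun m =>
  (fps_trunc (mdeg m).+1 f
     \mPo [tuple fps_trunc (mdeg m).+1 (g i) | i < k])@_m.

Definition formal_inverse n (F G : 'I_n -> fps n) : Prop :=
  [/\ forall i, F i 0%MM = 0, forall i, G i 0%MM = 0,
      forall i, fps_comp (F i) G =1 fps_of_mpoly 'X_i
    & forall i, fps_comp (G i) F =1 fps_of_mpoly 'X_i].

(* Series in (z, t) are series in n.+1 variables, where z_i is the variable of
   index [zvar i] and t is the last one; this is the convention of [mwiden]. *)
Definition zvar n (i : 'I_n) : 'I_n.+1 := widen_ord (leqnSn n) i.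
Definition tvar n : 'I_n.+1 := ord_max.

Definition fps_zorder_ge n (k : nat) (f : fps n.+1) : Prop :=
  forall m, f m != 0 -> (k <= \sum_(i < n) m (zvar i))%N.

(* (g_0, ..., g_(n-1)) extended by t, so that
   [fps_comp f (with_t g)] is f(g(z, t), t). *)
Definition with_t n (g : 'I_n -> fps n.+1) (j : 'I_n.+1) : fps n.+1 :=
  if unlift (tvar n) j is Some i then g i else fps_of_mpoly 'X_(tvar n).

Definition formal_zinverse n (F G : 'I_n -> fps n.+1) : Prop :=
  [/\ forall i, fps_zorder_ge 1 (F i), forall i, fps_zorder_ge 1 (G i),
      forall i, fps_comp (F i) (with_t G) =1 fps_of_mpoly 'X_(zvar i)
    & forall i, fps_comp (G i) (with_t F) =1 fps_of_mpoly 'X_(zvar i)].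

End FormalPowerSeries.

Section HessianNilpotent.
Variables (K : comNzRingType) (n : nat).
Implicit Types P : {mpoly K[n]}.

Definition jacobian (F : 'I_n -> {mpoly K[n]}) : 'M[{mpoly K[n]}]_n :=
  \matrix_(i, j) (F i)^`M(j).

Definition hessian P : 'M[{mpoly K[n]}]_n :=
  \matrix_(i, j) P^`M(i)^`M(j).

Definition hessian_nilpotent P : Prop := exists k : nat, hessian P ^+ k = 0.

Definition laplacian P : {mpoly K[n]} := \sum_(i < n) P^`M(i)^`M(i).

(* Q = Q_t(z), of order >= 2 in z, and z + t * grad Q_t is the inverse in z of
   z - t * grad P. *)
Definition deformed_inversion_pair P (Q : fps K n.+1) : Prop :=
  fps_zorder_ge 2 Q /\
  formal_zinverse
    (fun i => fps_of_mpoly ('X_(zvar i) - 'X_(tvar n) * mwiden P^`M(i)))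
    (fun i => fps_add (fps_of_mpoly 'X_(zvar i))
                (fps_mul (fps_of_mpoly 'X_(tvar n)) (fps_deriv (zvar i) Q))).

(* The property is stated in two forms, both required here; they agree for
   Hessian nilpotent P, where
   Q_t = \sum_k t^k / (2^k k! (k+1)!) Delta^k P^(k+1). *)
Definition vanishing_property P : Prop :=
  (exists Q : fps K n.+1, deformed_inversion_pair P Q /\ fps_polynomial Q) /\
  (exists k0 : nat, forall k : nat, (k0 <= k)%N ->
     iter k laplacian (P ^+ k.+1) = 0).

End HessianNilpotent.

(* Main.v *)
(* From quartic homogeneous P to the Jacobian conjecture. Composing (X - H, Y)
   with elementary automorphisms (Bass-Connell-Wright) trades the monomials of
   top degree > 3 for monomials of lower degree in more variables, and then the
   quadratic part for cubic terms with a homogenizing variable T. For a cubic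
   form H, det(1 - JH) = 1 forces JH to be nilpotent, and X - H is a factor of
   the map (x - H(x), y - JH(x)^T y), which is linearly conjugate to z - grad P
   with P(x, y) the Hessian nilpotent quartic form y . H(x) in suitable linear
   coordinates.

   From the Jacobian conjecture to any P. The map (z - t grad P, t) has Jacobian
   determinant 1, so it has a polynomial inverse (z + t N, t), and N is the
   gradient in z of an explicit polynomial Q. Moreover dQ/dt = |N|^2 / 2, and
   Delta_z Q, the trace of a nilpotent matrix, vanishes. Hence
   Delta_z Q^(m+1) = 2(m+1) d(Q^m)/dt, so that Delta_z^k Q^(k+1) is a multiple of
   d^k Q/dt^k, which is 0 for large k; put t = 0. *)
Require Import Defs.
From HB Require Import structures.
From mathcomp Require Import all_boot all_order all_algebra.
From mathcomp Require Import mpoly complex ring.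
From mathcomp Require Import boolp reals.

Set Implicit Arguments.
Unset Strict Implicit.
Unset Printing Implicit Defensive.

Import Order.TTheory GRing.Theory Num.Theory.
Local Open Scope ring_scope.

(** * Substitution in polynomials *)

Section Substitution.
Variable K : comNzRingType.

(** Constants and variables generate the polynomial ring, so identities between morphisms or
    derivations need only be checked on them. *)
Lemma mpoly_alg_ind n (P : {mpoly K[n]} -> Prop) :
  (forall c, P c%:MP) -> (forall i, P 'X_i) ->
  (forall p q, P p -> P q -> P (p + q)) ->
  (forall p q, P p -> P q -> P (p * q)) -> forall p, P p.
Proof.
move=> PC PX PD PM p; rewrite [p]mpolyE.
elim/big_rec: _ => [|m q _ Pq]; first by rewrite -mpolyC0; apply: PC.
apply: (PD) => //; rewrite -mul_mpolyC; apply: (PM) => //.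
rewrite mpolyXE_id; elim/big_rec: _ => [|i r _ Pr].
  by rewrite -mpolyC1; apply: PC.
apply: (PM) => //; elim: (m i) => [|k IH]; first by rewrite expr0 -mpolyC1.
by rewrite exprS; apply: PM.
Qed.

(** Images form a function, not a tuple, so that the maps [blk] and [text] below can be plugged in
    directly. For maps, [fun i => psub G (F i)] is [F] after [G]. *)
Definition psub n k (g : 'I_n -> {mpoly K[k]}) (p : {mpoly K[n]}) :
  {mpoly K[k]} := mmap (@mpolyC k K) g p.

HB.instance Definition _ n k (g : 'I_n -> {mpoly K[k]}) :=
  GRing.isAdditive.Build {mpoly K[n]} {mpoly K[k]} (psub g)
    (mmap_is_additive g (@mpolyC k K)).
HB.instance Definition _ n k (g : 'I_n -> {mpoly K[k]}) :=
  GRing.isMultiplicative.Build {mpoly K[n]} {mpoly K[k]} (psub g)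
    (mmap_is_multiplicative g (@mpolyC k K)).

Lemma psubC n k (g : 'I_n -> {mpoly K[k]}) c : psub g c%:MP = c%:MP.
Proof. exact: mmapC. Qed.

Lemma psubX n k (g : 'I_n -> {mpoly K[k]}) i : psub g 'X_i = g i.
Proof. by rewrite /psub mmapX mmap1U. Qed.

Lemma psubZ n k (g : 'I_n -> {mpoly K[k]}) c p :
  psub g (c *: p) = c *: psub g p.
Proof. by rewrite -mul_mpolyC rmorphM /= psubC mul_mpolyC. Qed.

Lemma psub_ext n k (g h : 'I_n -> {mpoly K[k]}) p :
  g =1 h -> psub g p = psub h p.
Proof. by move=> /funext ->. Qed.

Lemma psub_psub n k l (g : 'I_n -> {mpoly K[k]}) (h : 'I_k -> {mpoly K[l]}) p :
  psub h (psub g p) = psub (fun i => psub h (g i)) p.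
Proof.
elim/mpoly_alg_ind: p => [c|i|p q IHp IHq|p q IHp IHq].
- by rewrite !psubC.
- by rewrite !psubX.
- by rewrite !raddfD /= IHp IHq.
- by rewrite !rmorphM /= IHp IHq.
Qed.

Lemma psub_id n (p : {mpoly K[n]}) : psub (fun i => 'X_i) p = p.
Proof.
elim/mpoly_alg_ind: p => [c|i|p q IHp IHq|p q IHp IHq].
- by rewrite !psubC.
- by rewrite !psubX.
- by rewrite !raddfD /= IHp IHq.
- by rewrite !rmorphM /= IHp IHq.
Qed.

Lemma mderivXU n (i j : 'I_n) : ('X_i : {mpoly K[n]})^`M(j) = (i == j)%:R.
Proof.
rewrite mderivX mnm1E; case: eqP => [->|_]; last by rewrite scale0r.
have -> : (U_(j) - U_(j) = 0)%MM by apply/mnmP=> l; rewrite mnmBE subnn mnm0E.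
by rewrite mpolyX0 scale1r.
Qed.

(** Chain rule: both sides are derivations along the morphism [psub g]. *)
Lemma mderiv_psub n k (g : 'I_n -> {mpoly K[k]}) p j :
  (psub g p)^`M(j) = \sum_i psub g p^`M(i) * (g i)^`M(j).
Proof.
elim/mpoly_alg_ind: p => [c|i|p q IHp IHq|p q IHp IHq].
- by rewrite psubC mderivC big1 // => i _; rewrite mderivC raddf0 mul0r.
- rewrite psubX (bigD1 i) //= big1 => [|l ne_li].
    by rewrite mderivXU eqxx rmorph1 mul1r addr0.
  by rewrite mderivXU eq_sym (negbTE ne_li) raddf0 mul0r.
- rewrite raddfD /= mderivD IHp IHq -big_split /=; apply: eq_bigr => i _.
  by rewrite mderivD raddfD mulrDl.
- rewrite rmorphM /= mderivM IHp IHq mulr_suml mulr_sumr -big_split /=.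
  apply: eq_bigr => i _; rewrite mderivM raddfD /= !rmorphM /=; ring.
Qed.

Lemma mcoeff0_psub n k (g : 'I_n -> {mpoly K[k]}) p :
  (forall i, (g i)@_0%MM = 0) -> (psub g p)@_0%MM = p@_0%MM.
Proof.
move=> g0; elim/mpoly_alg_ind: p => [c|i|p q IHp IHq|p q IHp IHq].
- by rewrite psubC !mcoeffC !eqxx.
- by rewrite psubX g0 mcoeffX mnm1_eq0.
- by rewrite [psub _ _]raddfD !mcoeffD -IHp -IHq.
- by rewrite [psub _ _]rmorphM !rmorphM /= -IHp -IHq.
Qed.

End Substitution.

(* Used with [r := leq] and [r := geq], to bound the order resp. the degree. *)
Section DegreeBounds.
Variables (K : comNzRingType).

Definition degrel n (mf : 'X_{1..n} -> nat) (r : rel nat) a (p : {mpoly K[n]}) :=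
  {in msupp p, forall m, r a (mf m)}.

Variable r : rel nat.
Hypothesis r0 : r 0 0.
Hypothesis rD : forall a b c d, r a b -> r c d -> r (a + c)%N (b + d)%N.

Section Measure.
Variables (n : nat) (mf : measure n).
Implicit Types p q : {mpoly K[n]}.

Lemma degrel0 a : degrel mf r a (0 : {mpoly K[n]}).
Proof. by move=> m; rewrite -mpolyC0 msupp0. Qed.

Lemma degrelD a p q : degrel mf r a p -> degrel mf r a q -> degrel mf r a (p + q).
Proof.
move=> hp hq m /msuppD_le; rewrite mem_cat => /orP[]; [exact: hp|exact: hq].
Qed.

Lemma degrelN a p : degrel mf r a p -> degrel mf r a (- p).
Proof. by move=> hp m; rewrite (perm_mem (msuppN p)); apply: hp. Qed.

Lemma degrelB a p q : degrel mf r a p -> degrel mf r a q -> degrel mf r a (p - q).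
Proof. by move=> hp hq; apply: degrelD => //; apply: degrelN. Qed.

Lemma degrel_sum a (I : Type) (s : seq I) (P : pred I) (F : I -> {mpoly K[n]}) :
  (forall i, P i -> degrel mf r a (F i)) -> degrel mf r a (\sum_(i <- s | P i) F i).
Proof.
move=> hF; elim/big_ind: _ => //; [exact: degrel0 | exact: degrelD].
Qed.

Lemma degrelM a b p q :
  degrel mf r a p -> degrel mf r b q -> degrel mf r (a + b) (p * q).
Proof.
move=> hp hq m /msuppM_le /allpairsP[[m1 m2] /= [h1 h2 ->]].
by rewrite mfD; apply: rD; [apply: hp | apply: hq].
Qed.

Lemma degrelZ a c p : degrel mf r a p -> degrel mf r a (c *: p).
Proof. by move=> hp m /msuppZ_le; apply: hp. Qed.

Lemma degrelX a m : r a (mf m) -> degrel mf r a ('X_[m] : {mpoly K[n]}).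
Proof. by move=> h m'; rewrite msuppX inE => /eqP ->. Qed.

Lemma degrelC c : degrel mf r 0 (c%:MP : {mpoly K[n]}).
Proof.
rewrite -[_%:MP]mulr1 mul_mpolyC; apply/degrelZ.
by rewrite -mpolyX0; apply: degrelX; rewrite mf0.
Qed.

Lemma degrelXn a p e : degrel mf r a p -> degrel mf r (a * e) (p ^+ e).
Proof.
move=> hp; elim: e => [|e IH]; first by rewrite muln0 expr0 -mpolyC1; apply: degrelC.
by rewrite exprS mulnS; apply: degrelM.
Qed.

End Measure.

Hypothesis r_trans : transitive r.

Lemma degrelW n (mf : 'X_{1..n} -> nat) a b (p : {mpoly K[n]}) :
  r a b -> degrel mf r b p -> degrel mf r a p.
Proof. by move=> rab hp m /hp; apply: r_trans. Qed.

Lemma degrel_psub n k (mf : measure k) (g : 'I_n -> {mpoly K[k]}) c a p :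
  (forall i, degrel mf r c (g i)) -> degrel mdeg r a p ->
  degrel mf r (a * c) (psub g p).
Proof.
have rM b d : r b d -> r (b * c)%N (d * c)%N.
  move=> rbd; elim: c => [|c' IH]; first by rewrite !muln0.
  by rewrite !mulnS; apply: rD.
move=> hg hp; rewrite /psub /mmap big_seq; apply: degrel_sum => m m_p.
rewrite mul_mpolyC; apply/degrelZ/(degrelW (rM _ _ (hp m m_p))).
rewrite mdegE /mmap1 big_distrl /=; elim/big_ind2: _ => [|x1 x2 y1 y2 h1 h2|i _].
- by rewrite -mpolyC1; apply: degrelC.
- exact: degrelM.
- by rewrite mulnC; apply: degrelXn.
Qed.

End DegreeBounds.

Lemma degrel_leq_psub (K : comNzRingType) n k (mf : measure k)
    (g : 'I_n -> {mpoly K[k]}) c a p :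
  (forall i, degrel mf leq c (g i)) -> degrel mdeg leq a p ->
  degrel mf leq (a * c) (psub g p).
Proof.
apply: degrel_psub => //; first by move=> ? ? ? ?; apply: leq_add.
by move=> ? ? ?; apply: leq_trans.
Qed.

(** * Polynomial maps and their inverses *)

Section PolynomialMaps.
Variable K : fieldType.

Definition pinv n (F : 'I_n -> {mpoly K[n]}) : Prop :=
  exists G : 'I_n -> {mpoly K[n]},
    (forall i, psub G (F i) = 'X_i) /\ (forall i, psub F (G i) = 'X_i).

Lemma pinv_ext n (F G : 'I_n -> {mpoly K[n]}) : F =1 G -> pinv F -> pinv G.
Proof. by move=> /funext ->. Qed.

Lemma pinv_comp n (F G : 'I_n -> {mpoly K[n]}) :
  pinv F -> pinv G -> pinv (fun i => psub G (F i)).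
Proof.
move=> [F' [FF' F'F]] [G' [GG' G'G]]; exists (fun i => psub F' (G' i)); split=> i.
  rewrite psub_psub -[RHS]FF'; apply: psub_ext => j /=.
  by rewrite -psub_psub GG' psubX.
rewrite psub_psub -[RHS]G'G; apply: psub_ext => j /=.
by rewrite -psub_psub F'F psubX.
Qed.

(** As maps, [E = B^-1 o (B o E o A) o A^-1]. *)
Lemma pinv_cancel n (B E A : 'I_n -> {mpoly K[n]}) :
  pinv B -> pinv A -> pinv (fun i => psub A (psub E (B i))) -> pinv E.
Proof.
move=> [B' [BB' B'B]] [A' [AA' A'A]] invBEA.
have invB' : pinv B' by exists B.
have invA' : pinv A' by exists A.
apply: pinv_ext (pinv_comp (pinv_comp invB' invBEA) invA') => i.
have -> : psub (fun i => psub A (psub E (B i))) (B' i) = psub A (E i).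
  rewrite -[E i]psubX -[in RHS]B'B !psub_psub; apply: psub_ext => j.
  by rewrite psub_psub.
rewrite psub_psub -[RHS]psub_id; apply: psub_ext => j; exact: AA'.
Qed.

Lemma jacobian_psub n (F G : 'I_n -> {mpoly K[n]}) :
  jacobian (fun i => psub G (F i)) = map_mx (psub G) (jacobian F) *m jacobian G.
Proof.
apply/matrixP=> i j; rewrite !mxE mderiv_psub; apply: eq_bigr => l _.
by rewrite !mxE.
Qed.

Lemma jacobianX n : jacobian (fun i => 'X_i : {mpoly K[n]}) = 1%:M.
Proof. by apply/matrixP=> i j; rewrite !mxE mderivXU. Qed.

Lemma jacobianB n (F G : 'I_n -> {mpoly K[n]}) :
  jacobian (fun i => F i - G i) = jacobian F - jacobian G.
Proof. by apply/matrixP=> i j; rewrite !mxE raddfB. Qed.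

Lemma det_jacobian_psub n (F G : 'I_n -> {mpoly K[n]}) :
  \det (jacobian (fun i => psub G (F i))) =
  psub G (\det (jacobian F)) * \det (jacobian G).
Proof. by rewrite jacobian_psub det_mulmx det_map_mx. Qed.

(** Over a field the units are constants, hence determined by their value at the origin. *)
Lemma mpoly_unit1 n (p q : {mpoly K[n]}) : q * p = 1 -> p@_0%MM = 1 -> p = 1.
Proof.
by move=> /mpoly_intro_unit /andP[/eqP -> _]; rewrite mcoeffC eqxx mulr1 => ->.
Qed.

Definition order_ge n a (p : {mpoly K[n]}) := degrel mdeg leq a p.

Lemma order_geP n a (p : {mpoly K[n]}) :
  order_ge a p <-> fps_order_ge a (fps_of_mpoly p).
Proof.
by split=> h m; move: (h m); rewrite /fps_of_mpoly mcoeff_msupp.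
Qed.

Lemma order_ge_mcoeff0 n a (p : {mpoly K[n]}) :
  (0 < a)%N -> order_ge a p -> p@_0%MM = 0.
Proof.
move=> a_gt0 hp; apply: memN_msupp_eq0; apply: contraL a_gt0 => /hp.
by rewrite mdeg0 leqn0 => /eqP ->.
Qed.

Lemma order_ge_deriv n a (p : {mpoly K[n]}) i :
  order_ge a.+1 p -> order_ge a p^`M(i).
Proof.
move=> hp m; rewrite mcoeff_msupp mcoeff_mderiv => nz.
have : (m + U_(i))%MM \in msupp p.
  by rewrite mcoeff_msupp; apply: contraNneq nz => ->; rewrite mul0rn.
by move/hp; rewrite mdegD mdeg1 addn1.
Qed.

Lemma jacobian_order2_at0 n (H : 'I_n -> {mpoly K[n]}) :
  (forall i, order_ge 2 (H i)) -> map_mx (mcoeff 0%MM) (jacobian H) = 0.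
Proof.
move=> hH; apply/matrixP=> i j; rewrite !mxE.
exact/(@order_ge_mcoeff0 _ 1)/order_ge_deriv.
Qed.

(** By the chain rule the determinant is a unit, hence constant, and at the origin the Jacobian
    matrix is the identity because [H] has order at least 2. This spares explicit determinants for
    the elementary automorphisms below. *)
Lemma keller_of_pinv n (H : 'I_n -> {mpoly K[n]}) :
  (forall i, order_ge 2 (H i)) -> pinv (fun i => 'X_i - H i) ->
  \det (jacobian (fun i => 'X_i - H i)) = 1.
Proof.
move=> hH [G [FG GF]]; set F := fun i => _ in FG GF *.
have h : psub F (\det (jacobian G)) * \det (jacobian F) = 1.
  rewrite -det_jacobian_psub (_ : (fun i => _) = fun i => 'X_i) ?jacobianX ?det1 //.
  by apply/funext.
apply: (mpoly_unit1 h); rewrite -[LHS]det_map_mx jacobianB jacobianX raddfB /=.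
by rewrite map_mx1 jacobian_order2_at0 // subr0 det1.
Qed.

Lemma pinv_mcoeff0 n (F G : 'I_n -> {mpoly K[n]}) :
  (forall i, (F i)@_0%MM = 0) -> (forall i, psub F (G i) = 'X_i) ->
  forall i, (G i)@_0%MM = 0.
Proof.
move=> F0 GF i; rewrite -(mcoeff0_psub _ F0) GF.
by rewrite mcoeffX mnm1_eq0.
Qed.

End PolynomialMaps.

(** * Maps in two blocks of variables X and Y *)

Section Blocks.
Variable K : fieldType.

Definition blk n k T (f : 'I_n -> T) (g : 'I_k -> T) (j : 'I_(n + k)) : T :=
  match split j with inl i => f i | inr i => g i end.

Lemma blkl n k T (f : 'I_n -> T) (g : 'I_k -> T) i : blk f g (lshift k i) = f i.
Proof. by rewrite /blk (unsplitK (inl i)). Qed.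

Lemma blkr n k T (f : 'I_n -> T) (g : 'I_k -> T) i : blk f g (rshift n i) = g i.
Proof. by rewrite /blk (unsplitK (inr i)). Qed.

Lemma blk_ind n k (P : 'I_(n + k) -> Prop) :
  (forall i, P (lshift k i)) -> (forall i, P (rshift n i)) -> forall j, P j.
Proof. by move=> Pl Pr j; case: (split_ordP j) => i ->. Qed.

Definition wl n k := psub (fun i : 'I_n => 'X_(lshift k i) : {mpoly K[n + k]}).
Definition wr n k := psub (fun i : 'I_k => 'X_(rshift n i) : {mpoly K[n + k]}).

Lemma psub_wl n k m (h : 'I_(n + k) -> {mpoly K[m]}) p :
  psub h (wl k p) = psub (fun i => h (lshift k i)) p.
Proof. by rewrite psub_psub; apply: psub_ext => i; rewrite psubX. Qed.

Lemma psub_wr n k m (h : 'I_(n + k) -> {mpoly K[m]}) p :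
  psub h (wr n p) = psub (fun i => h (rshift n i)) p.
Proof. by rewrite psub_psub; apply: psub_ext => i; rewrite psubX. Qed.

Lemma mderiv_wl_l n k (p : {mpoly K[n]}) j :
  (wl k p)^`M(lshift k j) = wl k p^`M(j).
Proof.
rewrite mderiv_psub (bigD1 j) //= mderivXU eqxx mulr1 big1 ?addr0 // => i ne_ij.
by rewrite mderivXU eq_lshift (negbTE ne_ij) mulr0.
Qed.

Lemma mderiv_wl_r n k (p : {mpoly K[n]}) j : (wl k p)^`M(rshift n j) = 0.
Proof.
by rewrite mderiv_psub big1 // => i _; rewrite mderivXU eq_lrshift mulr0.
Qed.

Definition stab n k (F : 'I_n -> {mpoly K[n]}) :=
  blk (fun i => wl k (F i)) (fun j : 'I_k => 'X_(rshift n j) : {mpoly K[n + k]}).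
Arguments stab {n} k F _.

Lemma det_jacobian_stab n k (F : 'I_n -> {mpoly K[n]}) :
  \det (jacobian (stab k F)) = wl k (\det (jacobian F)).
Proof.
have -> : jacobian (stab k F) = block_mx (map_mx (wl k) (jacobian F)) 0 0 1%:M.
  apply/matrixP; elim/blk_ind => i; elim/blk_ind => j;
    rewrite (block_mxEul, block_mxEur, block_mxEdl, block_mxEdr) !mxE /stab
      ?(blkl, blkr).
  - by rewrite mderiv_wl_l.
  - by rewrite mderiv_wl_r.
  - by rewrite mderivXU eq_rlshift.
  - by rewrite mderivXU eq_rshift.
by rewrite det_lblock det1 mulr1 det_map_mx.
Qed.

(** Put [Y = 0]: since [g] vanishes there, the big map restricts to [F] on this subspace, and the
    [X]-components of [G] restricted to it invert [F]. *)
Lemma pinv_unstab n k (F : 'I_n -> {mpoly K[n]})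
    (g : 'I_k -> {mpoly K[n + k]}) :
  (forall j, psub (blk (fun i => 'X_i) (fun=> 0)) (g j) = 0) ->
  pinv (blk (fun i => wl k (F i)) g) -> pinv F.
Proof.
set e := blk _ _ => g0 [G [FG GF]].
exists (fun i => psub e (G (lshift k i))); split=> i.
  have := congr1 (psub e) (FG (lshift k i)).
  by rewrite blkl psub_wl psub_psub psubX /e blkl.
have := congr1 (psub e) (GF (lshift k i)).
rewrite psubX /e blkl -/e => <-; rewrite !psub_psub; apply: psub_ext.
elim/blk_ind => j; rewrite ?(blkl, blkr) /e ?(blkl, blkr) ?psubX -/e.
  by rewrite psub_wl -[LHS]psub_id; apply: psub_ext => l; rewrite /e blkl.
by rewrite g0 raddf0.
Qed.

End Blocks.

Arguments stab {K n} k F _.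

(** * Adjoining and specializing the variable t *)

Section ExtraVariable.
Variable K : fieldType.

Definition text n T (f : 'I_n -> T) (c : T) (j : 'I_n.+1) : T :=
  if unlift (tvar n) j is Some i then f i else c.

Lemma zvarE n (i : 'I_n) : zvar i = lift (tvar n) i.
Proof. by apply: val_inj; rewrite /= /bump leqNgt ltn_ord. Qed.

Lemma textz n T (f : 'I_n -> T) c i : text f c (zvar i) = f i.
Proof. by rewrite /text zvarE liftK. Qed.

Lemma textt n T (f : 'I_n -> T) c : text f c (tvar n) = c.
Proof. by rewrite /text unlift_none. Qed.

Lemma text_ind n (P : 'I_n.+1 -> Prop) :
  (forall i, P (zvar i)) -> P (tvar n) -> forall j, P j.
Proof.
by move=> Pz Pt j; case: (unliftP (tvar n) j) => [i ->|->] //; rewrite -zvarE.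
Qed.

Lemma eq_zvar n (i j : 'I_n) : (zvar i == zvar j) = (i == j).
Proof. by []. Qed.

Lemma eq_zvar_tvar n (i : 'I_n) : (zvar i == tvar n) = false.
Proof. by rewrite -val_eqE /= ltn_eqF. Qed.

Lemma mwiden_psub n (p : {mpoly K[n]}) : mwiden p = psub (fun i => 'X_(zvar i)) p.
Proof. by []. Qed.

Lemma psub_mwiden n k (h : 'I_n.+1 -> {mpoly K[k]}) p :
  psub h (mwiden p) = psub (fun i => h (zvar i)) p.
Proof. by rewrite mwiden_psub psub_psub; apply: psub_ext => i; rewrite psubX. Qed.

Lemma mderiv_mwiden_z n (p : {mpoly K[n]}) j :
  (mwiden p)^`M(zvar j) = mwiden p^`M(j).
Proof.
rewrite mwiden_psub mderiv_psub (bigD1 j) //= mderivXU eqxx mulr1.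
rewrite big1 ?addr0 // => i ne_ij.
by rewrite mderivXU eq_zvar (negbTE ne_ij) mulr0.
Qed.

Lemma mderiv_mwiden_t n (p : {mpoly K[n]}) : (mwiden p)^`M(tvar n) = 0.
Proof.
by rewrite mwiden_psub mderiv_psub big1 // => i _; rewrite mderivXU eq_zvar_tvar mulr0.
Qed.

Definition tX n : {mpoly K[n.+1]} := 'X_(tvar n).

Lemma mderiv_t_z n j : (tX n)^`M(zvar j) = 0.
Proof. by rewrite mderivXU eq_sym eq_zvar_tvar. Qed.

Lemma mderiv_t_t n : (tX n)^`M(tvar n) = 1.
Proof. by rewrite mderivXU eqxx. Qed.

Lemma mderiv_psub_z n k (g : 'I_n.+1 -> {mpoly K[k]}) p j :
  (psub g p)^`M(j) = \sum_(i < n) psub g p^`M(zvar i) * (g (zvar i))^`M(j)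
                     + psub g p^`M(tvar n) * (g (tvar n))^`M(j).
Proof. by rewrite mderiv_psub big_ord_recr. Qed.

Definition zjacobian n (f : 'I_n -> {mpoly K[n.+1]}) :=
  \matrix_(i, j) (f i)^`M(zvar j).

Lemma det_jacobian_text n (f : 'I_n -> {mpoly K[n.+1]}) :
  \det (jacobian (text f (tX n))) = \det (zjacobian f).
Proof.
rewrite (expand_det_row _ (tvar n)) big_ord_recr /= big1 => [|j _]; last first.
  by rewrite mxE textt (mderiv_t_z j) mul0r.
rewrite add0r mxE textt mderiv_t_t mul1r /cofactor -signr_odd oddD addbb expr0.
rewrite mul1r; congr (\det _); apply/matrixP=> i j.
by rewrite !mxE -!zvarE textz.
Qed.

Definition evt n (c : K) := psub (text (fun i => 'X_i : {mpoly K[n]}) c%:MP).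

Lemma evt_mwiden n c (p : {mpoly K[n]}) : evt c (mwiden p) = p.
Proof.
by rewrite /evt psub_mwiden -[RHS]psub_id; apply: psub_ext => i; rewrite textz.
Qed.

Lemma evtz n c i : evt c ('X_(zvar i)) = 'X_i :> {mpoly K[n]}.
Proof. by rewrite /evt psubX textz. Qed.

Lemma evtt n c : evt c (tX n) = c%:MP.
Proof. by rewrite /evt psubX textt. Qed.

Lemma mderiv_evt n c (p : {mpoly K[n.+1]}) i :
  (evt c p)^`M(i) = evt c p^`M(zvar i).
Proof.
rewrite mderiv_psub_z textt mderivC mulr0 addr0 (bigD1 i) //= textz mderivXU.
rewrite eqxx mulr1 big1 ?addr0 // => j ne_ji.
by rewrite textz mderivXU (negbTE ne_ji) mulr0.
Qed.

(** The inverse of a map that fixes the coordinate [t] fixes it too ([Gt]), so both composition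
    identities can be specialized at [t = c]. *)
Lemma pinv_evt n c (f : 'I_n -> {mpoly K[n.+1]}) :
  pinv (text f (tX n)) -> pinv (fun i => evt c (f i)).
Proof.
move=> [G [FG GF]].
have Gt : G (tvar n) = tX n by rewrite -[RHS]FG textt psubX.
exists (fun i => evt c (G (zvar i))); split=> i.
  rewrite -(evtz c) -FG textz /evt !psub_psub; apply: psub_ext; elim/text_ind.
    by move=> j; rewrite textz psubX.
  by rewrite textt psubC Gt psubX textt.
rewrite -(evtz c) -GF /evt !psub_psub; apply: psub_ext; elim/text_ind.
  by move=> j; rewrite !textz psubX.
by rewrite !textt psubC psubX textt.
Qed.

End ExtraVariable.

(** * Reduction to cubic homogeneous maps *)

(* Bass-Connell-Wright: [X - H] is Keller resp. invertible iff
   [B o (X - H, Y) o A] is, where [A], [B] are the elementary automorphisms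
   [(X, Y + A(X))] and [(X + S(X, Y), Y)]. *)
Section Reduction.
Variable K : fieldType.
Variables (n k : nat) (H : 'I_n -> {mpoly K[n]}).
Variables (A : 'I_k -> {mpoly K[n]}) (S : 'I_n -> {mpoly K[n + k]}).

Definition amap : 'I_(n + k) -> {mpoly K[n + k]} :=
  blk (fun i => 'X_(lshift k i)) (fun j => 'X_(rshift n j) + wl k (A j)).

Definition bmap : 'I_(n + k) -> {mpoly K[n + k]} :=
  blk (fun i => 'X_(lshift k i) + S i) (fun j => 'X_(rshift n j)).

(** What [B o (X - H, Y) o A] subtracts from the identity; in it, [S] is evaluated at
    [(X - H(X), Y + A(X))]. *)
Definition redH : 'I_(n + k) -> {mpoly K[n + k]} :=
  blk (fun i => wl k (H i) - psub amap (psub (stab k (fun i => 'X_i - H i)) (S i)))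
      (fun j => - wl k (A j)).

Lemma psub_amap_wl p : psub amap (wl k p) = wl k p.
Proof. by rewrite psub_wl; apply: psub_ext => i; rewrite /amap blkl. Qed.

Lemma redHE i : 'X_i - redH i =
  psub amap (psub (stab k (fun i => 'X_i - H i)) (bmap i)).
Proof.
elim/blk_ind: i => i; rewrite /redH /bmap ?(blkl, blkr).
  rewrite [psub (stab _ _) (_ + _)]raddfD [psub amap (_ + _)]raddfD /= psubX.
  rewrite {2}/stab blkl psub_amap_wl /wl [psub _ (_ - _)]raddfB /= psubX; ring.
by rewrite psubX /stab blkr psubX /amap blkr opprK.
Qed.

Lemma pinv_amap : pinv amap.
Proof.
exists (blk (fun i => 'X_(lshift k i)) (fun j => 'X_(rshift n j) - wl k (A j))).
have hA f j : psub (blk (fun i => 'X_(lshift k i)) f) (wl k (A j)) = wl k (A j).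
  by rewrite psub_wl; apply: psub_ext => i; rewrite blkl.
split; elim/blk_ind => i; rewrite ?(blkl, blkr) /amap ?(blkl, blkr).
- by rewrite psubX blkl.
- by rewrite raddfD /= psubX blkr hA subrK.
- by rewrite psubX blkl.
- by rewrite raddfB /= psubX blkr hA addrK.
Qed.

Hypothesis S_inv : forall (s : K) i,
  psub (blk (fun i => 'X_(lshift k i) + s *: S i) (fun j => 'X_(rshift n j)))
    (S i) = S i.

(** The inverse subtracts [S]: by [S_inv] with [s = 1] and [s = -1], [S] has the same value before
    and after [X] is shifted by [S] or [-S]. *)
Lemma pinv_bmap : pinv bmap.
Proof.
exists (blk (fun i => 'X_(lshift k i) - S i) (fun j => 'X_(rshift n j))).
have S_inv1 i : psub bmap (S i) = S i.
  rewrite -[RHS](S_inv 1); apply: psub_ext => j; rewrite /bmap /blk.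
  by case: split => // l; rewrite scale1r.
have S_invN i : psub (blk (fun i => 'X_(lshift k i) - S i)
                          (fun j => 'X_(rshift n j))) (S i) = S i.
  rewrite -[RHS](S_inv (-1)); apply: psub_ext => j; rewrite /blk.
  by case: split => // l; rewrite scaleN1r.
split; elim/blk_ind => i; rewrite ?(blkl, blkr) /bmap ?(blkl, blkr) -/bmap.
- by rewrite raddfD /= psubX blkl S_invN subrK.
- by rewrite psubX blkr.
- by rewrite raddfB /= psubX {1}/bmap blkl S_inv1 addrK.
- by rewrite psubX /bmap blkr.
Qed.

Hypothesis A_order : forall j, order_ge 2 (A j).
Hypothesis S_order : forall i, order_ge 2 (S i).

Lemma order_ge_wl a m l (p : {mpoly K[m]}) : order_ge a p -> order_ge a (wl l p).
Proof.
move=> hp; rewrite -[a]muln1; apply: degrel_leq_psub hp => i.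
by apply: degrelX; rewrite /= mdeg1.
Qed.

(** Determinants multiply under composition, and those of both automorphisms are 1 by
    [keller_of_pinv]. *)
Lemma red_keller : \det (jacobian (fun i => 'X_i - H i)) = 1 ->
  \det (jacobian (fun i => 'X_i - redH i)) = 1.
Proof.
move=> kF; rewrite (funext redHE) det_jacobian_psub.
have -> : \det (jacobian amap) = 1.
  have E : amap = fun i => 'X_i - blk (fun=> 0) (fun j => - wl k (A j)) i.
    by apply/funext; elim/blk_ind => i; rewrite /amap !(blkl, blkr) ?subr0 ?opprK.
  rewrite E; apply: keller_of_pinv; last by rewrite -E; apply: pinv_amap.
  by elim/blk_ind => i; rewrite ?(blkl, blkr); 
    [apply: degrel0 | apply/degrelN/order_ge_wl].
rewrite mulr1 det_jacobian_psub det_jacobian_stab kF /wl rmorph1 mulr1.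
have -> : \det (jacobian bmap) = 1.
  have E : bmap = fun i => 'X_i - blk (fun i => - S i) (fun=> 0) i.
    by apply/funext; elim/blk_ind => i; rewrite /bmap !(blkl, blkr) ?subr0 ?opprK.
  rewrite E; apply: keller_of_pinv; last by rewrite -E; apply: pinv_bmap.
  by elim/blk_ind => i; rewrite ?(blkl, blkr); 
    [apply/degrelN/S_order | apply: degrel0].
by rewrite !rmorph1.
Qed.

Lemma red_pinv :
  pinv (fun i => 'X_i - redH i) -> pinv (fun i => 'X_i - H i).
Proof.
rewrite (funext redHE) => /(pinv_cancel pinv_bmap pinv_amap).
by apply: pinv_unstab => j; rewrite psubX blkr.
Qed.

End Reduction.

(** * Lowering the degree to 3; nilpotency from the determinant *)

Section CubicReduction.
Variable K : fieldType.

(** [deg_in d d] expresses homogeneity of degree [d], zero included. *)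
Definition deg_in n lo hi (p : {mpoly K[n]}) :=
  order_ge lo p /\ degrel mdeg geq hi p.

Lemma geq_add a b c d : geq a b -> geq c d -> geq (a + c) (b + d).
Proof. exact: leq_add. Qed.

Lemma geq_transitive : transitive geq.
Proof. by move=> a b c /= h1 h2; apply: leq_trans h2 h1. Qed.

Lemma order_geM n a b (p q : {mpoly K[n]}) :
  order_ge a p -> order_ge b q -> order_ge (a + b) (p * q).
Proof. by apply: degrelM => ? ? ? ?; apply: leq_add. Qed.

Lemma order_geW n a b (p : {mpoly K[n]}) :
  (a <= b)%N -> order_ge b p -> order_ge a p.
Proof. by apply: degrelW => ? ? ?; apply: leq_trans. Qed.

Lemma deg_in0 n lo hi : deg_in lo hi (0 : {mpoly K[n]}).
Proof. by split; apply: degrel0. Qed.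

Lemma deg_inD n lo hi (p q : {mpoly K[n]}) :
  deg_in lo hi p -> deg_in lo hi q -> deg_in lo hi (p + q).
Proof. by move=> [? ?] [? ?]; split; apply: degrelD. Qed.

Lemma deg_inN n lo hi (p : {mpoly K[n]}) : deg_in lo hi p -> deg_in lo hi (- p).
Proof. by move=> [? ?]; split; apply: degrelN. Qed.

Lemma deg_inZ n lo hi c (p : {mpoly K[n]}) :
  deg_in lo hi p -> deg_in lo hi (c *: p).
Proof. by move=> [? ?]; split; apply: degrelZ. Qed.

Lemma deg_inM n lo hi lo' hi' (p q : {mpoly K[n]}) :
  deg_in lo hi p -> deg_in lo' hi' q -> deg_in (lo + lo') (hi + hi') (p * q).
Proof.
move=> [? ?] [? ?]; split; first exact: order_geM.
by apply: degrelM => //; apply: geq_add.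
Qed.

Lemma deg_inX n lo hi m :
  (lo <= mdeg m <= hi)%N -> deg_in lo hi ('X_[m] : {mpoly K[n]}).
Proof. by move=> /andP[? ?]; split; apply: degrelX. Qed.

Lemma deg_inW n lo hi lo' hi' (p : {mpoly K[n]}) :
  (lo' <= lo)%N -> (hi <= hi')%N -> deg_in lo hi p -> deg_in lo' hi' p.
Proof.
move=> h1 h2 [? ?]; split; first exact: order_geW h1 _.
by apply: (degrelW (r := geq) geq_transitive (b := hi)).
Qed.

Lemma deg_in_psub n k (g : 'I_n -> {mpoly K[k]}) c lo hi p :
  (forall i, deg_in c c (g i)) -> deg_in lo hi p ->
  deg_in (lo * c) (hi * c) (psub g p).
Proof.
move=> hg [h1 h2]; split; first by apply: degrel_leq_psub => // i; case: (hg i).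
apply: degrel_psub => // [||i]; [exact: geq_add | exact: geq_transitive |].
by case: (hg i).
Qed.

Lemma deg_in_wl n k lo hi (p : {mpoly K[n]}) :
  deg_in lo hi p -> deg_in lo hi (wl k p).
Proof.
rewrite -{2}[lo]muln1 -{2}[hi]muln1; apply: deg_in_psub => i.
by apply: deg_inX; rewrite mdeg1.
Qed.

Lemma deg_in_eq0 n lo hi (p : {mpoly K[n]}) :
  (hi < lo)%N -> deg_in lo hi p -> p = 0.
Proof.
move=> lt_hl [h1 h2]; apply/eqP; rewrite -msupp_eq0.
case E: (msupp p) => [//|m s]; have m_p : m \in msupp p by rewrite E inE eqxx.
by move: (leq_trans (h1 m m_p) (h2 m m_p)); rewrite leqNgt lt_hl.
Qed.

Definition JCdeg d := forall n (H : 'I_n -> {mpoly K[n]}),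
  (forall i, deg_in 2 d (H i)) ->
  \det (jacobian (fun i => 'X_i - H i)) = 1 -> pinv (fun i => 'X_i - H i).

Lemma mnm_gt0P n (m : 'X_{1..n}) : (0 < mdeg m)%N -> exists i, m i != 0%N.
Proof.
rewrite lt0n mdeg_eq0 => nz; apply/existsP; apply: contraNT nz.
rewrite negb_exists => /forallP h.
by apply/eqP/mnmP=> i; rewrite mnm0E; apply/eqP; rewrite -[_ == _]negbK h.
Qed.

Lemma mnm_split2 n (m : 'X_{1..n}) : (2 <= mdeg m)%N ->
  exists a b, m = (a + b)%MM /\ mdeg a = 2%N.
Proof.
have split1 (l : 'X_{1..n}) : (0 < mdeg l)%N -> exists i b, l = (U_(i) + b)%MM.
  case/mnm_gt0P => i nz_i.
  by exists i, (l - U_(i))%MM; rewrite addmC submK // lep1mP.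
move=> m2; have [|i [b mE]] := split1 m; first exact: leq_trans m2.
have [|j [c bE]] := split1 b.
  by move: m2; rewrite mE mdegD mdeg1.
exists (U_(i) + U_(j))%MM, c; rewrite mE bE addmA; split=> //.
by rewrite mdegD !mdeg1.
Qed.

Section DegreeStep.
Variables (n d : nat).
Hypothesis d3 : (3 <= d)%N.

Let mon (j : 'I_#|{: 'X_{1..n < d.+1}}|) : 'X_{1..n} := enum_val j.

Lemma mon_surj (m : 'X_{1..n}) : (mdeg m <= d)%N -> exists j, mon j = m.
Proof.
move=> m_d; exists (enum_rank (BMultinom (m_d : mdeg m < d.+1)%N)).
by rewrite /mon enum_rankK.
Qed.

(** Every monomial of degree at most [d] gets a new variable; those of degree 0 and 1 get the shift
    0, which keeps [A] of order at least 2. *)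
Definition stepA j : {mpoly K[n]} := if (2 <= mdeg (mon j))%N then 'X_[mon j] else 0.

Local Notation k := #|{: 'X_{1..n < d.+1}}|.
Local Notation T := (fun j : 'I_k =>
  'X_(rshift n j) + wl k (stepA j) : {mpoly K[n + k]}).

(* A monomial [X^(a+b)] of degree [d + 1 >= 4] with [|a| = 2] differs from
   [(Y_a + X^a)(Y_b + X^b)] by terms of degree at most [d]. *)
Lemma step_split (p : {mpoly K[n]}) : deg_in 2 d.+1 p ->
  exists s : {mpoly K[k]}, order_ge 2 s /\ deg_in 2 d (wl k p - psub T s).
Proof.
move=> [p_lo p_hi]; rewrite [p]mpolyE big_seq; elim/big_rec: _ => [|m q m_p].
  exists 0; split; first exact: degrel0.
  by rewrite [psub _ 0]raddf0 subr0 /wl raddf0; apply: deg_in0.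
move=> [s [s2 hs]].
suff [s' [s'2 hs']] : exists s' : {mpoly K[k]},
    order_ge 2 s' /\ deg_in 2 d (wl k 'X_[m] - psub T s').
  exists (p@_m *: s' + s); split; first by apply: degrelD => //; apply: degrelZ.
  rewrite {1}/wl [psub _ (_ *: 'X_[_] + _)]raddfD [psub T _]raddfD /= !psubZ.
  rewrite opprD addrACA -scalerBr.
  by apply: deg_inD => //; apply: deg_inZ.
have := p_lo m m_p; have := p_hi m m_p => {m_p} /=.
rewrite leq_eqVlt => /orP[/eqP m_d|]; last first.
  rewrite ltnS => m_d m_2; exists 0; split; first exact: degrel0.
  by rewrite raddf0 subr0; apply/deg_in_wl/deg_inX; rewrite m_2.
move=> m_2; have [a [b [mE a2]]] := mnm_split2 m_2.
have bE : (mdeg b).+1 = d.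
  by apply/eqP; rewrite -eqSS -m_d mE mdegD a2 !addSn.
have [ja jaE] : exists j, mon j = a by apply: mon_surj; rewrite a2 ltnW.
have [jb jbE] : exists j, mon j = b by apply: mon_surj; rewrite -bE.
(* [b] has degree [d - 1], so [3 <= d] ensures that [stepA] shifts its variable by [X^b] and not by
   0. *)
have b2 : (2 <= mdeg b)%N by rewrite -ltnS bE.
exists ('X_ja * 'X_jb); split.
  by apply: (@order_geM _ 1 1); apply: degrelX; rewrite /= mdeg1.
rewrite rmorphM /= !psubX /stepA jaE jbE a2 b2 /= mE mpolyXD.
rewrite {1}/wl rmorphM /= -/(wl k 'X_[a]) -/(wl k 'X_[b]).
set u := wl k _; set v := wl k _.
set x := 'X_(rshift n ja); set y := 'X_(rshift n jb).
have -> : u * v - (x + u) * (y + v) = - (x * y + x * v + u * y) by ring.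
have hx : deg_in 1 1 x by apply: deg_inX; rewrite mdeg1.
have hy : deg_in 1 1 y by apply: deg_inX; rewrite mdeg1.
have hu : deg_in 2 2 u by apply/deg_in_wl/deg_inX; rewrite a2.
have hv : deg_in 2 (mdeg b) v by apply/deg_in_wl/deg_inX; rewrite b2 leqnn.
apply/deg_inN/deg_inD; first apply: deg_inD.
- by apply: deg_inW (deg_inM hx hy) => //; apply: ltnW.
- by apply: deg_inW (deg_inM hx hv) => //; rewrite add1n bE.
- exact: deg_inW (deg_inM hu hy).
Qed.

(** [S] is a polynomial in the new variables alone, so neither a shift of [X] nor [(X - H, Y)]
    changes it. The reduced [X]-part is [H(X) - s(Y + A(X))], of degree at most [d] by
    [step_split]. *)
Lemma JCdeg_step_n (H : 'I_n -> {mpoly K[n]}) :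
  JCdeg d -> (forall i, deg_in 2 d.+1 (H i)) ->
  \det (jacobian (fun i => 'X_i - H i)) = 1 -> pinv (fun i => 'X_i - H i).
Proof.
move=> JC hH kH; have [s hs] := choice (fun i => step_split (hH i)).
pose S i : {mpoly K[n + k]} := wr n (s i).
have A2 j : deg_in 2 d (stepA j).
  rewrite /stepA; case: ifP => [m2|_]; last exact: deg_in0.
  by apply: deg_inX; rewrite m2 -ltnS bmdeg.
have S_inv (c : K) i :
    psub (blk (fun i => 'X_(lshift k i) + c *: S i) (fun j => 'X_(rshift n j)))
      (S i) = S i.
  by rewrite psub_wr; apply: psub_ext => j; rewrite blkr.
have S2 i : order_ge 2 (S i).
  rewrite -[2%N]muln1; apply: degrel_leq_psub (hs i).1 => j.
  by apply: degrelX; rewrite /= mdeg1.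
apply: (red_pinv (A := stepA) S_inv); apply: JC; last first.
  by apply: red_keller => // j; case: (A2 j).
elim/blk_ind => i; rewrite /redH ?(blkl, blkr); last first.
  by apply/deg_inN/deg_in_wl.
have -> : psub (stab k (fun i => 'X_i - H i)) (S i) = S i.
  by rewrite psub_wr; apply: psub_ext => j; rewrite /stab blkr.
rewrite psub_wr (psub_ext (h := T)); first exact: (hs i).2.
by move=> j; rewrite /amap blkr.
Qed.

End DegreeStep.

Lemma JCdeg_step d : (3 <= d)%N -> JCdeg d -> JCdeg d.+1.
Proof. by move=> d3 JC n H hH; apply: (JCdeg_step_n d3). Qed.

(* If [B] is the inverse of [1 - M], the entries of
   [M^k B = B - \sum_(i < k) M^i] have order at least [2 k] and, for [k] large,
   degree less than [2 k]. *)
Lemma nilpotent_of_det1 n (M : 'M[{mpoly K[n]}]_n) :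
  (forall i j, deg_in 2 2 (M i j)) -> \det (1%:M - M) = 1 ->
  exists k, M ^+ k = 0.
Proof.
move=> hM det1M; pose B := \adj (1%:M - M).
have MB : (1%:M - M) *m B = 1%:M by rewrite mul_mx_adj det1M.
clearbody B.
pose D := \max_i \max_j msize (B i j).
have hB i j : degrel mdeg geq D (B i j).
  move=> m /msize_mdeg_lt /ltnW /leq_trans; apply.
  by apply: leq_trans (leq_bigmax i); apply: (leq_bigmax j).
have hMk k i j : deg_in (2 * k) (2 * k) ((M ^+ k) i j).
  elim: k i j => [|k IH] i j.
    rewrite expr0 mxE; case: (i == j); last exact: deg_in0.
    by rewrite mulr1n -mpolyX0; apply: deg_inX; rewrite mdeg0.
  rewrite exprS mxE; elim/big_rec: _ => [|l p _ hp]; first exact: deg_in0.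
  by apply: deg_inD hp; rewrite mulnS; apply: deg_inM.
have geom k : M ^+ k *m B = B - \sum_(i < k) M ^+ i.
  elim: k => [|k IH]; first by rewrite big_ord0 subr0 expr0 mul1mx.
  rewrite big_ord_recr /= opprD addrA -IH exprSr -mulmxE.
  have -> : M ^+ k *m M *m B = M ^+ k *m B - M ^+ k.
    rewrite -[in X in _ = _ - X](mulmx1 (M ^+ k)) -MB mulmxBl mul1mx mulmxBr.
    by rewrite opprB addrC subrK mulmxA.
  by [].
(* Entries of [M^(D+1) B] have order at least [2D + 2], but degree at most [2D]: those of [B] have
   degree at most [D], and the last subtracted power is [M^D]. *)
exists D.+1.
have MkB : M ^+ D.+1 *m B = 0.
  apply/matrixP=> i j; rewrite [RHS]mxE.
  apply: (@deg_in_eq0 _ (2 * D.+1) (2 * D)); first by rewrite ltn_mul2l ltnS leqnn.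
  split.
    rewrite mxE; apply: degrel_sum => l _; rewrite -[(2 * _)%N]addn0.
    by apply: order_geM => //; case: (hMk D.+1 i l).
  rewrite geom !mxE; apply: degrelB.
    by apply: (degrelW (r := geq) geq_transitive _ (hB i j)); rewrite /= leq_pmull.
  rewrite summxE; apply: degrel_sum => l _; case: (hMk l i j) => _.
  by apply: (degrelW (r := geq) geq_transitive); rewrite /= leq_mul2l -ltnS ltn_ord.
have BM : B *m (1%:M - M) = 1%:M by apply: mulmx1C.
by rewrite -[LHS]mulmx1 -BM mulmxA MkB mul0mx.
Qed.

(** Nilpotency takes the place of the determinant condition because it is what passes to the Hessian
    of the symmetrized quartic. *)
Definition JCcubic := forall n (H : 'I_n -> {mpoly K[n]}), (0 < n)%N ->
  (forall i, deg_in 3 3 (H i)) -> (exists k, jacobian H ^+ k = 0) ->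
  pinv (fun i => 'X_i - H i).

End CubicReduction.

(** * From degree at most 3 to cubic forms *)

Section Homogenization.
Variable K : fieldType.

Lemma deg_in_split23 n (p : {mpoly K[n]}) : deg_in 2 3 p ->
  exists q : {mpoly K[n]} * {mpoly K[n]},
    [/\ p = q.1 + q.2, deg_in 2 2 q.1 & deg_in 3 3 q.2].
Proof.
move=> [p_lo p_hi]; rewrite [p]mpolyE big_seq; elim/big_rec: _ => [|m q m_p].
  by exists (0, 0); rewrite addr0; split=> //; apply: deg_in0.
move=> [[q2 q3] /= [-> hq2 hq3]].
have := p_lo m m_p; have := p_hi m m_p => {m_p} /=; rewrite leq_eqVlt.
case/orP=> [/eqP m3 _|m2 m2'].
  exists (q2, p@_m *: 'X_[m] + q3); split=> //=; first by rewrite addrCA.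
  by apply: deg_inD => //; apply/deg_inZ/deg_inX; rewrite m3.
exists (p@_m *: 'X_[m] + q2, q3); split=> //=; first by rewrite addrA.
by apply: deg_inD => //; apply/deg_inZ/deg_inX; rewrite m2' -ltnS m2.
Qed.

Definition scalet n := psub (fun j : 'I_n => tX K n * 'X_(zvar j)).

Lemma scalet_homog n d (p : {mpoly K[n]}) :
  deg_in d d p -> scalet p = tX K n ^+ d * mwiden p.
Proof.
have scaleX (m : 'X_{1..n}) :
    scalet 'X_[m] = tX K n ^+ mdeg m * psub (fun i => 'X_(zvar i)) 'X_[m].
  rewrite mpolyXE_id mdegE /scalet !rmorph_prod -prodrXr -big_split /=.
  by apply: eq_bigr => i _; rewrite !rmorphXn /= !psubX exprMn.
move=> [lo hi]; rewrite mwiden_psub [p]mpolyE /scalet !raddf_sum mulr_sumr.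
rewrite !big_seq; apply: eq_bigr => m m_p; rewrite /= !psubZ -scalerAr.
congr (_ *: _); rewrite -/(scalet _) scaleX; congr (_ ^+ _ * _).
by apply/eqP; rewrite eqn_leq; apply/andP; split; [exact: hi | exact: lo].
Qed.

Section CubicStep.
Variables (n : nat) (H2 H3 : 'I_n -> {mpoly K[n]}).
Hypothesis hH2 : forall i, deg_in 2 2 (H2 i).
Hypothesis hH3 : forall i, deg_in 3 3 (H3 i).
Let H i := H2 i + H3 i.

Definition homogH i := tX K n * mwiden (H2 i) + tX K n ^+ 2 * mwiden (H3 i).

Lemma homog_text i : 'X_i - text homogH 0 i =
  text (fun i => 'X_(zvar i) - homogH i) (tX K n) i.
Proof.
by elim/text_ind: i => [i|]; rewrite ?textz ?textt // subr0.
Qed.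

(* [t F_t(z) = F(t z)] for [F_t = z - t H_2 - t^2 H_3]. *)
Lemma homog_keller : \det (jacobian (fun i => 'X_i - H i)) = 1 ->
  \det (jacobian (fun i => 'X_i - text homogH 0 i)) = 1.
Proof.
move=> kH; rewrite (funext homog_text) det_jacobian_text.
have <- : scalet (\det (jacobian (fun i => 'X_i - H i))) = 1.
  by rewrite kH /scalet rmorph1.
rewrite /scalet -det_map_mx; congr (\det _); apply/matrixP=> i j; rewrite 3!mxE.
have t_neq0 : tX K n != 0 by rewrite -msupp_eq0 msuppX.
(* Differentiating [t F_t(z) = F(t z)] in [z_j] produces a factor [t] on both sides, which is
   cancelled. *)
apply: (mulfI t_neq0).
have E : tX K n * ('X_(zvar i) - homogH i) = scalet ('X_i - H i).
  have -> : scalet ('X_i - H i) = scalet 'X_i - (scalet (H2 i) + scalet (H3 i)).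
    by rewrite /scalet raddfB /= raddfD.
  rewrite (scalet_homog (hH2 i)) (scalet_homog (hH3 i)) {1}/scalet psubX.
  by rewrite /homogH; ring.
have := congr1 (mderiv (zvar j)) E.
rewrite mderivM (mderiv_t_z K j) mul0r add0r => ->.
rewrite /scalet mderiv_psub (bigD1 j) //= mderivM mderiv_t_z mul0r add0r.
rewrite mderivXU eqxx mulr1 mulrC big1 ?addr0 // => l ne_lj.
by rewrite mderivM mderiv_t_z mul0r add0r mderivXU eq_zvar (negbTE ne_lj) !mulr0.
Qed.

(* [(X - T H_2 - T^2 H_3) - T^2 (Y - H_3) = X - T H_2 - T^2 Y] is [X] minus a
   cubic form. *)
Definition cubicA j : {mpoly K[n.+1]} := - mwiden (H3 j).
Definition cubicS : 'I_n.+1 -> {mpoly K[n.+1 + n]} :=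
  text (fun i => - (wl n (tX K n) ^+ 2 * 'X_(rshift n.+1 i))) 0.

Lemma wl_tX : wl n (tX K n) = 'X_(lshift n (tvar n)).
Proof. exact: psubX. Qed.

Lemma psub_cubicS k (h : 'I_(n.+1 + n) -> {mpoly K[k]}) i :
  psub h (cubicS (zvar i)) =
  - (h (lshift n (tvar n)) ^+ 2 * h (rshift n.+1 i)).
Proof.
rewrite /cubicS textz wl_tX raddfN /= rmorphM rmorphXn /= !psubX //.
Qed.

Lemma deg_in_mwiden lo hi (p : {mpoly K[n]}) :
  deg_in lo hi p -> deg_in lo hi (mwiden p).
Proof.
rewrite -{2}[lo]muln1 -{2}[hi]muln1; apply: deg_in_psub => i.
by apply: deg_inX; rewrite mdeg1.
Qed.

Lemma cubic_redH i :
  deg_in 3 3 (redH (text homogH 0) cubicA cubicS i).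
Proof.
have ht : deg_in 1 1 (wl n (tX K n)).
  by apply/deg_in_wl/deg_inX; rewrite mdeg1.
elim/blk_ind: i => i; rewrite /redH ?(blkl, blkr); last first.
  by apply/deg_inN/deg_in_wl/deg_inN/deg_in_mwiden.
elim/text_ind: i => [i|]; last first.
  rewrite /cubicS !textt [psub _ 0]raddf0 [psub _ 0]raddf0 /wl raddf0 subr0.
  exact: deg_in0.
have -> : psub (amap cubicA) (psub (stab n (fun i => 'X_i - text homogH 0 i))
    (cubicS (zvar i))) =
    - (wl n (tX K n) ^+ 2 * ('X_(rshift n.+1 i) - wl n (mwiden (H3 i)))).
  rewrite psub_cubicS /stab blkl blkr textt subr0 -/(tX K n) raddfN /=.
  rewrite rmorphM rmorphXn /= psub_amap_wl psubX /amap blkr.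
  by congr (- (_ * (_ + _))); rewrite /cubicA /wl raddfN.
have -> : wl n (text homogH 0 (zvar i)) = wl n (tX K n) * wl n (mwiden (H2 i))
    + wl n (tX K n) ^+ 2 * wl n (mwiden (H3 i)).
  by rewrite textz /wl /homogH raddfD /= !rmorphM /= expr2.
set t := wl n (tX K n) in ht *; set a := wl n _; set b := wl n _; set y := 'X__.
have -> : t * a + t ^+ 2 * b - - (t ^+ 2 * (y - b)) = t * a + t * t * y by ring.
apply: deg_inD; first by apply: (deg_inM ht); apply/deg_in_wl/deg_in_mwiden.
by apply: (deg_inM (deg_inM ht ht)); apply: deg_inX; rewrite mdeg1.
Qed.

(** [S] involves only [T] and [Y], and its [T]-component is 0, so the shift changes neither. *)
Lemma cubicS_inv (c : K) i :
  psub (blk (fun i => 'X_(lshift n i) + c *: cubicS i)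
            (fun j => 'X_(rshift n.+1 j))) (cubicS i) = cubicS i.
Proof.
elim/text_ind: i => [i|]; last by rewrite /cubicS textt raddf0.
rewrite psub_cubicS blkl blkr {1 2}/cubicS textt textz scaler0 addr0.
by rewrite -wl_tX.
Qed.

Lemma cubic_step : JCcubic K ->
  \det (jacobian (fun i => 'X_i - H i)) = 1 -> pinv (fun i => 'X_i - H i).
Proof.
move=> JC kH.
suff : pinv (text (fun i => 'X_(zvar i) - homogH i) (tX K n)).
  (* At [T = 1], [X - T H_2 - T^2 H_3] is the original map. *)
  move=> /(pinv_evt 1); apply: pinv_ext => i.
  rewrite /evt raddfB /= psubX textz /homogH raddfD /= !rmorphM /=.
  by rewrite psubX textt -!/(evt 1 _) !evt_mwiden mpolyC1 !mul1r.
rewrite -(funext homog_text); apply: (red_pinv (A := cubicA) cubicS_inv).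
apply: JC => // [i|]; first exact: cubic_redH.
apply: nilpotent_of_det1.
  move=> i j; rewrite mxE; have [lo hi] := cubic_redH i.
  split; first exact: order_ge_deriv.
  move=> m; rewrite mcoeff_msupp mcoeff_mderiv => nz.
  have /hi : (m + U_(j))%MM \in msupp (redH (text homogH 0) cubicA cubicS i).
    by rewrite mcoeff_msupp; apply: contraNneq nz => ->; rewrite mul0rn.
  by rewrite /= mdegD mdeg1 addn1.
rewrite -jacobianX -jacobianB; apply: red_keller; last exact: homog_keller.
- exact: cubicS_inv.
- move=> j; have [h _] : deg_in 3 3 (cubicA j) by apply/deg_inN/deg_in_mwiden.
  exact: order_geW h.
- elim/text_ind => [j|]; rewrite /cubicS ?(textz, textt); last exact: degrel0.
  have ht : order_ge 1 (wl n (tX K n)).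
    by apply/order_ge_wl/degrelX; rewrite /= mdeg1.
  apply/degrelN; apply: (@order_geW _ _ _ (2 + 0)%N) => //.
  by apply: order_geM => //; rewrite expr2; apply: (@order_geM _ _ 1 1).
Qed.

End CubicStep.

(** Induction on the degree bound, starting at 3 with [cubic_step]; weakening [d] to [d + 3] first
    avoids treating small [d] apart. *)
Lemma JCdeg_of_cubic d : JCcubic K -> JCdeg K d.
Proof.
move=> JC; suff JCn k : JCdeg K (k + 3).
  move=> n H hH; apply: (JCn d) => i; apply: deg_inW (hH i) => //.
  exact: leq_addr.
elim: k => [|k IH]; last by rewrite addSn; apply: JCdeg_step; rewrite ?leq_addl.
move=> n H hH; have [q hq] := choice (fun i => deg_in_split23 (hH i)).
have E : H = fun i => (q i).1 + (q i).2.
  by apply/funext => i; case: (hq i).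
by rewrite E; apply: cubic_step => // i; case: (hq i).
Qed.

End Homogenization.

(** * Reduction to gradient maps *)

Section LinearMaps.
Variables (K : fieldType) (n : nat).

Definition linmap (C : 'M[K]_n) (b : 'I_n) : {mpoly K[n]} := \sum_a C b a *: 'X_a.

Lemma psub_linmap C (f : 'I_n -> {mpoly K[n]}) b :
  psub f (linmap C b) = \sum_a C b a *: f a.
Proof. by rewrite raddf_sum; apply: eq_bigr => a _; rewrite /= psubZ psubX. Qed.

Lemma linmap1 b : linmap 1%:M b = 'X_b.
Proof.
rewrite /linmap (bigD1 b) //= mxE eqxx scale1r big1 ?addr0 // => a ne_ab.
by rewrite mxE eq_sym (negbTE ne_ab) scale0r.
Qed.

Lemma psub_linmap_linmap C D b : psub (linmap D) (linmap C b) = linmap (C *m D) b.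
Proof.
rewrite psub_linmap /linmap; under eq_bigr do rewrite scaler_sumr.
rewrite exchange_big; apply: eq_bigr => a _; rewrite mxE scaler_suml.
by apply: eq_bigr => c _; rewrite scalerA.
Qed.

Lemma pinv_linmap C D : C *m D = 1%:M -> pinv (linmap C).
Proof.
move=> CD; exists (linmap D); split=> i; rewrite psub_linmap_linmap ?CD ?linmap1 //.
by rewrite (mulmx1C CD) linmap1.
Qed.

Lemma jacobian_linmap C : jacobian (linmap C) = map_mx (@mpolyC n K) C.
Proof.
apply/matrixP=> b a; rewrite !mxE raddf_sum (bigD1 a) //= mderivZ mderivXU eqxx.
rewrite big1 => [|c ne_ca]; last by rewrite mderivZ mderivXU (negbTE ne_ca) scaler0.
by rewrite addr0 -mul_mpolyC mulr1.
Qed.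

End LinearMaps.

(** In the [k]-th power only the lower left block survives, and such a matrix has square 0. *)
Lemma block_lower_nilpotent (A : comNzRingType) n m (M : 'M[A]_n) (L : 'M[A]_(m, n))
    (N : 'M[A]_m) k :
  M ^+ k = 0 -> N ^+ k = 0 -> block_mx M 0 L N ^+ (k + k) = 0.
Proof.
move=> Mk Nk; have blockX e : exists L',
    block_mx M 0 L N ^+ e = block_mx (M ^+ e) 0 L' (N ^+ e).
  elim: e => [|e [L' IH]]; first by exists 0; rewrite !expr0 -scalar_mx_block.
  exists (L *m M ^+ e + N *m L'); rewrite !exprS IH -!mulmxE mulmx_block.
  by rewrite !mul0mx !mulmx0 !addr0 !add0r.
have [L' E] := blockX k.
by rewrite exprD E Mk Nk -mulmxE mulmx_block !(mul0mx, mulmx0, addr0) block_mx0.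
Qed.

(* Meng, de Bondt - van den Essen: up to the linear change of variables [C],
   with [C C^T] the exchange of [x] and [y], the gradient map of
   [\sum_i y_i H_i(x)] is [(H(x), JH(x)^T y)]. *)
Section Symmetrization.
Variables (K : fieldType) (im : K).
Hypothesis im2 : im ^+ 2 = -1.
Hypothesis two_neq0 : 2%:R != 0 :> K.
Variables (n : nat) (H : 'I_n -> {mpoly K[n]}).

(** The substitution [x = u + im v], [y = (u - im v) / 2]; the diagonal blocks of [C C^T] vanish
    because [1 + im^2 = 0]. *)
Definition symC : 'M[K]_(n + n) :=
  block_mx 1%:M im%:M (2^-1)%:M (- (im / 2))%:M.

Definition swapmx : 'M[K]_(n + n) := block_mx 0 1%:M 1%:M 0.

Lemma symC_tr : symC *m symC^T = swapmx.
Proof.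
rewrite /symC tr_block_mx !tr_scalar_mx mulmx_block -!scalar_mxM -!raddfD /=.
have E : im * im = -1 by rewrite -expr2.
congr block_mx.
- by rewrite E mul1r subrr raddf0.
- congr (_%:M); rewrite mul1r mulrN mulrA E mulN1r opprK.
  by field.
- congr (_%:M); rewrite mulr1 mulNr mulrAC E mulN1r opprK; by field.
- have -> : 2^-1 * 2^-1 + - (im / 2) * - (im / 2) = 2^-1 * 2^-1 * (1 + im * im).
    by field.
  by rewrite E subrr mulr0 raddf0.
Qed.

Lemma swapmx2 : swapmx *m swapmx = 1%:M.
Proof.
rewrite /swapmx mulmx_block !(mul0mx, mulmx0, mul1mx, mulmx1) !(addr0, add0r).
by rewrite -scalar_mx_block.
Qed.

Lemma symC_inv : symC *m (symC^T *m swapmx) = 1%:M.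
Proof. by rewrite mulmxA symC_tr swapmx2. Qed.

Definition pairing : {mpoly K[n + n]} := \sum_i 'X_(rshift n i) * wl n (H i).

Lemma mderiv_pairing_r j : pairing^`M(rshift n j) = wl n (H j).
Proof.
rewrite raddf_sum (bigD1 j) //= mderivM mderivXU eqxx mul1r mderiv_wl_r mulr0.
rewrite addr0 big1 ?addr0 // => i ne_ij.
by rewrite mderivM mderivXU eq_rshift (negbTE ne_ij) mul0r mderiv_wl_r mulr0 addr0.
Qed.

Lemma mderiv_pairing_l j :
  pairing^`M(lshift n j) = \sum_i 'X_(rshift n i) * wl n (H i)^`M(j).
Proof.
rewrite raddf_sum; apply: eq_bigr => i _.
by rewrite /= mderivM mderivXU eq_rlshift mul0r add0r mderiv_wl_l.
Qed.

Definition pairR : 'I_(n + n) -> {mpoly K[n + n]} :=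
  blk (fun i => pairing^`M(rshift n i)) (fun i => pairing^`M(lshift n i)).

Lemma pairRE b : pairR b = \sum_c swapmx b c *: pairing^`M(c).
Proof.
rewrite big_split_ord /=; elim/blk_ind: b => b; rewrite /pairR ?(blkl, blkr).
  rewrite big1 ?add0r => [|c _]; last by rewrite block_mxEul mxE scale0r.
  rewrite (bigD1 b) //= block_mxEur mxE eqxx scale1r big1 ?addr0 // => c ne_cb.
  by rewrite block_mxEur mxE eq_sym (negbTE ne_cb) scale0r.
rewrite [X in _ + X]big1 ?addr0 => [|c _]; last by rewrite block_mxEdr mxE scale0r.
rewrite (bigD1 b) //= block_mxEdl mxE eqxx scale1r big1 ?addr0 // => c ne_cb.
by rewrite block_mxEdl mxE eq_sym (negbTE ne_cb) scale0r.
Qed.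

(** [H(x)] does not involve [y], and [JH(x)^T y] is linear in [y]. The lower left block stays
    unspecified, as nilpotency depends on the diagonal blocks alone. *)
Lemma jacobian_pairR : exists L,
  jacobian pairR = block_mx (map_mx (wl n) (jacobian H)) 0 L
                            (map_mx (wl n) (jacobian H))^T.
Proof.
exists (dlsubmx (jacobian pairR)); apply/matrixP.
elim/blk_ind => i; elim/blk_ind => j;
  rewrite ?block_mxEul ?block_mxEur ?block_mxEdl ?block_mxEdr !mxE /pairR ?(blkl, blkr).
- by rewrite mderiv_pairing_r mderiv_wl_l.
- by rewrite mderiv_pairing_r mderiv_wl_r.
- by [].
- rewrite mderiv_pairing_l raddf_sum (bigD1 j) //= mderivM mderivXU eqxx mul1r.
  rewrite mderiv_wl_r mulr0 addr0 big1 ?addr0 // => l ne_lj.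
  by rewrite mderivM mderivXU eq_rshift (negbTE ne_lj) mul0r mderiv_wl_r mulr0 addr0.
Qed.

Lemma jacobian_pairR_nilpotent :
  (exists k, jacobian H ^+ k = 0) -> exists k, jacobian pairR ^+ k = 0.
Proof.
move=> [k Hk]; have [L ->] := jacobian_pairR; exists (k + k)%N.
have E : map_mx (wl n) (jacobian H) ^+ k = 0.
  by rewrite /wl -rmorphXn /= Hk map_mx0.
apply: block_lower_nilpotent => //; rewrite -[LHS]trmxK -[RHS]trmxK; congr (_^T).
rewrite trmx0 -{}E; elim: k {Hk} => [|k IH]; first by rewrite !expr0 trmx1.
by rewrite exprSr exprS -!mulmxE trmx_mul trmxK IH.
Qed.

Definition symP : {mpoly K[n + n]} := psub (linmap symC) pairing.

(** By the chain rule [grad symP = C^T (grad pairing)(C z)], and [C C^T] exchanges the two halves of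
    the gradient. *)
Lemma linmap_symC_grad b :
  \sum_a symC b a *: symP^`M(a) = psub (linmap symC) (pairR b).
Proof.
have E a : symP^`M(a) = \sum_c symC c a *: psub (linmap symC) pairing^`M(c).
  rewrite mderiv_psub; apply: eq_bigr => c _.
  have /matrixP/(_ c a) := jacobian_linmap symC.
  by rewrite !mxE => ->; rewrite mulrC mul_mpolyC.
under eq_bigr do rewrite E scaler_sumr.
rewrite exchange_big pairRE raddf_sum; apply: eq_bigr => c _ /=.
rewrite psubZ -symC_tr mxE scaler_suml; apply: eq_bigr => a _.
by rewrite [symC^T _ _]mxE scalerA.
Qed.

(** Differentiating [linmap_symC_grad] gives [C Hess(symP) = J(pairR)(C z) C], so the Hessian is
    conjugate to a nilpotent matrix. *)
Lemma symP_hessian_nilpotent :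
  (exists k, jacobian H ^+ k = 0) -> hessian_nilpotent symP.
Proof.
move=> /jacobian_pairR_nilpotent [k Rk]; exists k.
set C := map_mx (@mpolyC (n + n) K) symC.
set M := map_mx (psub (linmap symC)) (jacobian pairR).
have CH : C *m hessian symP = M *m C.
  rewrite /M /C -jacobian_linmap -jacobian_psub.
  apply/matrixP=> b c; rewrite [RHS]mxE -linmap_symC_grad raddf_sum [LHS]mxE.
  apply: eq_bigr => a _; rewrite /= mderivZ jacobian_linmap !mxE.
  by rewrite mul_mpolyC.
have CHe e : C *m hessian symP ^+ e = M ^+ e *m C.
  elim: e => [|e IH]; first by rewrite !expr0 mul1mx mulmx1.
  by rewrite exprSr exprSr -!mulmxE mulmxA IH -!mulmxA CH.
have Mk : M ^+ k = 0 by rewrite /M -rmorphXn /= Rk map_mx0.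
have := CHe k; rewrite Mk mul0mx.
move=> /(congr1 (mulmx (map_mx (@mpolyC _ K) (symC^T *m swapmx)))).
by rewrite mulmxA -map_mxM (mulmx1C symC_inv) map_mx1 mul1mx mulmx0.
Qed.

Lemma deg_in_symP d : (forall i, deg_in d d (H i)) -> deg_in d.+1 d.+1 symP.
Proof.
move=> hH; have hp : deg_in d.+1 d.+1 pairing.
  rewrite /pairing; elim/big_ind: _ => [|p q|i _];
    [exact: deg_in0 | exact: deg_inD |].
  rewrite -add1n; apply: deg_inM; last exact: deg_in_wl.
  by apply: deg_inX; rewrite mdeg1.
have hC b : deg_in 1 1 (linmap symC b).
  rewrite /linmap; elim/big_ind: _ => [|p q|i _];
    [exact: deg_in0 | exact: deg_inD |].
  by apply/deg_inZ/deg_inX; rewrite mdeg1.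
by rewrite -[d.+1]muln1; apply: deg_in_psub.
Qed.

(** [C] conjugates [z - grad symP] to [(x, y) - pairR], whose first half is [x - H(x)] and whose
    second half vanishes for [y = 0]. *)
Lemma pinv_symP : pinv (fun a => 'X_a - symP^`M(a)) -> pinv (fun i => 'X_i - H i).
Proof.
move=> Pinv; have Cinv := pinv_linmap symC_inv.
have : pinv (fun b => 'X_b - pairR b).
  have idinv : pinv (fun b : 'I_(n + n) => 'X_b : {mpoly K[n + n]}).
    by exists (fun b => 'X_b); split=> i; rewrite psubX.
  apply: (pinv_cancel idinv Cinv); apply: pinv_ext (pinv_comp Cinv Pinv) => b.
  rewrite psubX raddfB /= psubX -linmap_symC_grad psub_linmap -sumrB.
  by apply: eq_bigr => a _; rewrite scalerBr.
pose g j := 'X_(rshift n j) - pairR (rshift n j).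
move=> h; apply: (@pinv_unstab K n n _ g).
  move=> j; rewrite /g raddfB /= psubX blkr /pairR blkr mderiv_pairing_l.
  rewrite [psub _ (bigop _ _ _)]raddf_sum.
  by rewrite big1 ?oppr0 ?addr0 // => i _; rewrite /= rmorphM /= psubX blkr mul0r.
apply: pinv_ext h; elim/blk_ind => i; rewrite ?(blkl, blkr) //.
by rewrite /pairR blkl mderiv_pairing_r /wl raddfB /= psubX.
Qed.

End Symmetrization.

Lemma cubic_of_symmetric (K : fieldType) (im : K) :
  im ^+ 2 = -1 -> 2%:R != 0 :> K ->
  (forall n (P : {mpoly K[n]}), (0 < n)%N -> deg_in 4 4 P ->
     hessian_nilpotent P -> pinv (fun i => 'X_i - P^`M(i))) ->
  JCcubic K.
Proof.
move=> im2 two_neq0 hyp n H n_gt0 hH nilH.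
apply: (pinv_symP im2 two_neq0); apply: hyp; first by rewrite addn_gt0 n_gt0.
  exact: deg_in_symP.
exact: symP_hessian_nilpotent.
Qed.

(** * Formal series and polynomials *)

Lemma mulrB_telescope (A : comNzRingType) (a b c e : A) :
  a * c - b * e = (a - b) * c + (c - e) * b.
Proof. ring. Qed.

Lemma addrB_telescope (A : comNzRingType) (a b c e : A) :
  a + c - (b + e) = a - b + (c - e).
Proof. ring. Qed.

(** Polynomials of order at least [d] form an ideal, and substitution respects congruence modulo an
    ideal. *)
Lemma degrel_psub_congr (K : comNzRingType) n k (mf : measure k) d
    (g h : 'I_n -> {mpoly K[k]}) p :
  (forall i, degrel mf leq d (g i - h i)) ->
  degrel mf leq d (psub g p - psub h p).
Proof.
move=> gh; elim/mpoly_alg_ind: p => [c|i|p q IHp IHq|p q IHp IHq].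
- by rewrite !psubC subrr; apply: degrel0.
- by rewrite !psubX.
- by rewrite (raddfD (psub g)) (raddfD (psub h)) addrB_telescope; apply: degrelD.
- rewrite !rmorphM /= mulrB_telescope.
  by apply: degrelD; rewrite -[d]addn0; apply: degrelM => // *; apply: leq_add.
Qed.

Section FormalToPolynomial.
Variable K : fieldType.

Lemma fps_trunc_mpoly n d (p : {mpoly K[n]}) :
  order_ge d (p - fps_trunc d (fps_of_mpoly p)).
Proof.
move=> m; rewrite mcoeff_msupp leqNgt; apply: contra => m_d.
rewrite mcoeffB /fps_trunc (mcoeff_mpoly (fun m => fps_of_mpoly p m)) //.
by rewrite subrr.
Qed.

(** As the [g i] have no constant term, dropping the terms of [f] and the [g i] of degree above
    [mdeg m] changes the composite only in degrees above [mdeg m]. *)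
Lemma fps_comp_mpoly n k (f : {mpoly K[k]}) (g : 'I_k -> {mpoly K[n]}) :
  (forall i, (g i)@_0%MM = 0) ->
  fps_comp (fps_of_mpoly f) (fun i => fps_of_mpoly (g i)) = fps_of_mpoly (psub g f).
Proof.
move=> g0; apply/funext => m; rewrite /fps_comp /comp_mpoly.
set d := (mdeg m).+1; set f' := fps_trunc _ _.
pose g' i := fps_trunc d (fps_of_mpoly (g i)).
have -> : mmap (@mpolyC n K) (tnth [tuple g' i | i < k]) f' = psub g' f'.
  by apply: psub_ext => i; rewrite tnth_mktuple.
have h1 : order_ge d (psub g f - psub g f').
  have : order_ge (d * 1) (psub g (f - f')).
    apply: degrel_leq_psub (@fps_trunc_mpoly _ d f) => i l.
    rewrite mcoeff_msupp lt0n; apply: contra.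
    by rewrite mdeg_eq0 => /eqP ->; rewrite g0.
  by rewrite muln1 raddfB.
have h2 : order_ge d (psub g f' - psub g' f').
  by apply: degrel_psub_congr => i; apply: fps_trunc_mpoly.
have : order_ge d (psub g f - psub g' f').
  by have := degrelD h1 h2; rewrite subrKA.
move=> /(_ m); rewrite mcoeff_msupp mcoeffB subr_eq0 => h.
by apply/esym/eqP; apply: contraT => /h; rewrite ltnn.
Qed.

Lemma fps_of_mpoly_inj n : injective (@fps_of_mpoly K n).
Proof. by move=> p q pq; apply/mpolyP => m; apply: (congr1 (fun f => f m) pq). Qed.

Lemma fps_add_mpoly n (p q : {mpoly K[n]}) :
  fps_add (fps_of_mpoly p) (fps_of_mpoly q) = fps_of_mpoly (p + q).
Proof. by apply/funext=> m; rewrite /fps_of_mpoly mcoeffD. Qed.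

Lemma fps_mul_mpoly n (p q : {mpoly K[n]}) :
  fps_mul (fps_of_mpoly p) (fps_of_mpoly q) = fps_of_mpoly (p * q).
Proof. by apply/funext=> m; rewrite /fps_of_mpoly mcoeffM. Qed.

Lemma fps_deriv_mpoly n i (p : {mpoly K[n]}) :
  fps_deriv i (fps_of_mpoly p) = fps_of_mpoly p^`M(i).
Proof. by apply/funext=> m; rewrite /fps_of_mpoly mcoeff_deriv. Qed.

Lemma with_t_mpoly n (g : 'I_n -> {mpoly K[n.+1]}) :
  with_t (fun i => fps_of_mpoly (g i)) = fun j => fps_of_mpoly (text g (tX K n) j).
Proof. by apply/funext=> j; rewrite /with_t /text; case: unlift. Qed.

Lemma formal_inverse_mpoly n (F G : 'I_n -> {mpoly K[n]}) :
  (forall i, (F i)@_0%MM = 0) ->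
  formal_inverse (fun i => fps_of_mpoly (F i)) (fun i => fps_of_mpoly (G i)) <->
  (forall i, psub G (F i) = 'X_i) /\ (forall i, psub F (G i) = 'X_i).
Proof.
move=> F0; split=> [[_ G0 FG GF]|[FG GF]].
  split=> i; apply: fps_of_mpoly_inj; apply/funext.
    by rewrite -fps_comp_mpoly.
  by rewrite -fps_comp_mpoly.
have G0 := pinv_mcoeff0 F0 GF.
by split=> // i; rewrite fps_comp_mpoly ?FG ?GF.
Qed.

(** Made a measure below, so that the degree bounds apply to the order in [z] alone. *)
Definition zdeg n (m : 'X_{1..n.+1}) := (\sum_(i < n) m (zvar i))%N.

Lemma zdeg0 n : zdeg (0%MM : 'X_{1..n.+1}) = 0%N.
Proof. by rewrite /zdeg big1 // => i _; rewrite mnm0E. Qed.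

Lemma zdegD n : {morph @zdeg n : m1 m2 / (m1 + m2)%MM >-> (m1 + m2)%N}.
Proof.
by move=> m1 m2; rewrite /zdeg -big_split; apply: eq_bigr => i _; rewrite mnmDE.
Qed.

HB.instance Definition _ n := isMeasure.Build n.+1 (@zdeg n) (@zdeg0 n) (@zdegD n).

Definition zorder_ge n a (p : {mpoly K[n.+1]}) := degrel (@zdeg n) leq a p.

Lemma zorder_geP n a (p : {mpoly K[n.+1]}) :
  zorder_ge a p <-> fps_zorder_ge a (fps_of_mpoly p).
Proof.
by split=> h m; move: (h m); rewrite /fps_of_mpoly mcoeff_msupp.
Qed.

Lemma zorder_ge_mcoeff0 n (p : {mpoly K[n.+1]}) : zorder_ge 1 p -> p@_0%MM = 0.
Proof.
move=> hp; apply/eqP; apply: contraT; rewrite -mcoeff_msupp => /hp.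
by rewrite zdeg0.
Qed.

Lemma zorder_geM n a b (p q : {mpoly K[n.+1]}) :
  zorder_ge a p -> zorder_ge b q -> zorder_ge (a + b) (p * q).
Proof. by apply: degrelM => ? ? ? ?; apply: leq_add. Qed.

Lemma zorder_geX n (i : 'I_n) : zorder_ge 1 ('X_(zvar i) : {mpoly K[n.+1]}).
Proof.
apply: degrelX; rewrite /= /zdeg (bigD1 i) //= mnm1E eqxx; exact: leq_addr.
Qed.

Lemma zorder_ge_psub n k (g : 'I_k -> {mpoly K[n.+1]}) a p :
  (forall i, zorder_ge 1 (g i)) -> order_ge a p -> zorder_ge a (psub g p).
Proof.
by move=> hg hp; rewrite -[a]muln1; apply: degrel_leq_psub.
Qed.

Lemma formal_zinverse_mpoly n (f g : 'I_n -> {mpoly K[n.+1]}) :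
  (forall i, zorder_ge 1 (f i)) -> (forall i, zorder_ge 1 (g i)) ->
  formal_zinverse (fun i => fps_of_mpoly (f i)) (fun i => fps_of_mpoly (g i)) <->
  (forall i, psub (text g (tX K n)) (f i) = 'X_(zvar i)) /\
  (forall i, psub (text f (tX K n)) (g i) = 'X_(zvar i)).
Proof.
have no_const (h : 'I_n -> {mpoly K[n.+1]}) : (forall i, zorder_ge 1 (h i)) ->
    forall j, (text h (tX K n) j)@_0%MM = 0.
  move=> hh; elim/text_ind => [i|]; rewrite ?(textz, textt).
    exact: zorder_ge_mcoeff0.
  by rewrite mcoeffX mnm1_eq0.
move=> f1 g1; split=> [[_ _ FG GF]|[FG GF]].
  split=> i; apply: fps_of_mpoly_inj; apply/funext.
    by move: (FG i); rewrite with_t_mpoly fps_comp_mpoly //; apply: no_const.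
  by move: (GF i); rewrite with_t_mpoly fps_comp_mpoly //; apply: no_const.
split=> i; try by apply/zorder_geP.
  by rewrite with_t_mpoly fps_comp_mpoly ?FG //; apply: no_const.
by rewrite with_t_mpoly fps_comp_mpoly ?GF //; apply: no_const.
Qed.

Section Pair.
Variables (n : nat) (P : {mpoly K[n]}).

Definition gradt i : {mpoly K[n.+1]} := 'X_(zvar i) - tX K n * mwiden P^`M(i).

Lemma zorder_gradt : order_ge 2 P -> forall i, zorder_ge 1 (gradt i).
Proof.
move=> P2 i; apply: degrelB; first exact: zorder_geX.
rewrite -[1%N]add0n; apply: zorder_geM; first by [].
rewrite mwiden_psub; apply: zorder_ge_psub; first exact: zorder_geX.
exact: order_ge_deriv.
Qed.

Lemma deformed_inversion_pair_mpoly (q : {mpoly K[n.+1]}) :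
  order_ge 2 P -> zorder_ge 2 q ->
  deformed_inversion_pair P (fps_of_mpoly q) <->
  (forall i, psub (text (fun i => 'X_(zvar i) + tX K n * q^`M(zvar i)) (tX K n))
                  (gradt i) = 'X_(zvar i)) /\
  (forall i, psub (text gradt (tX K n))
                  ('X_(zvar i) + tX K n * q^`M(zvar i)) = 'X_(zvar i)).
Proof.
move=> P2 q2; rewrite /deformed_inversion_pair.
have -> : (fun i => fps_add (fps_of_mpoly 'X_(zvar i))
            (fps_mul (fps_of_mpoly 'X_(tvar n))
                     (fps_deriv (zvar i) (fps_of_mpoly q))))
    = fun i => fps_of_mpoly ('X_(zvar i) + tX K n * q^`M(zvar i)).
  by apply/funext=> i; rewrite fps_deriv_mpoly fps_mul_mpoly fps_add_mpoly.
have g1 i : zorder_ge 1 ('X_(zvar i) + tX K n * q^`M(zvar i)).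
  apply: degrelD; first exact: zorder_geX.
  rewrite -[1%N]add0n; apply: zorder_geM; first by [].
  move=> m; rewrite mcoeff_msupp mcoeff_mderiv => nz.
  have : (m + U_(zvar i))%MM \in msupp q.
    by rewrite mcoeff_msupp; apply: contraNneq nz => ->; rewrite mul0rn.
  move/q2; rewrite zdegD addnC; suff -> : zdeg U_(zvar i) = 1%N by [].
  rewrite /zdeg (bigD1 i) //= mnm1E eqxx big1 // => j ne_ji.
  by rewrite mnm1E eq_zvar eq_sym (negbTE ne_ji).
have iff := formal_zinverse_mpoly (zorder_gradt P2) g1.
split=> [[_ /iff //]|/iff h]; split=> //; exact/zorder_geP.
Qed.

(** With [Q] polynomial, [(z + t grad Q, t)] is a polynomial inverse of [(z - t grad P, t)]; put
    [t = 1]. *)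
Lemma vanishing_pinv : order_ge 2 P -> vanishing_property P ->
  pinv (fun i => 'X_i - P^`M(i)).
Proof.
move=> P2 [[Q [dQ [q /funext Qq]]] _]; subst Q.
have q2 : zorder_ge 2 q by case: dQ => /zorder_geP.
have [FG GF] := (deformed_inversion_pair_mpoly P2 q2).1 dQ.
have : pinv (text gradt (tX K n)).
  exists (text (fun i => 'X_(zvar i) + tX K n * q^`M(zvar i)) (tX K n)).
  by split; elim/text_ind => [i|]; rewrite ?textz ?textt ?FG ?GF // psubX textt.
move=> /(pinv_evt 1); apply: pinv_ext => i.
by rewrite /evt raddfB /= rmorphM /= -!/(evt 1 _) evtz evtt mpolyC1 mul1r evt_mwiden.
Qed.

End Pair.

End FormalToPolynomial.

(** * The deformed inversion pair of a Hessian nilpotent polynomial *)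

(** [X^k = X^k - M^k] is a multiple of [X - M], so the characteristic polynomial divides a power of
    [X]. Being monic, it is itself a power of [X], and its trace coefficient is 0. *)
Lemma mxtrace_nilpotent (A : idomainType) n (M : 'M[A]_n) k :
  M ^+ k = 0 -> \tr M = 0.
Proof.
case: n M => [|n] M Mk; first by rewrite /mxtrace big_ord0.
pose x : 'M[{poly A}]_n.+1 := 'X%:M; pose y := map_mx (@polyC A) M.
have comm_xy : GRing.comm x y.
  by rewrite /GRing.comm /x -!mulmxE mul_scalar_mx mul_mx_scalar.
have yk : y ^+ k = 0 by rewrite /y -rmorphXn /= Mk map_mx0.
have := subrXX_comm k comm_xy; rewrite yk subr0 => /(congr1 determinant).
rewrite -mulmxE det_mulmx -/(char_poly M) /x -rmorphXn /= det_scalar -exprM => E.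
have : char_poly M %| ('X - 0%:P) ^+ (k * n.+1).
  by rewrite polyC0 subr0 E dvdp_mulIl.
case/dvdp_exp_XsubCP=> j _; rewrite polyC0 subr0.
rewrite eqp_monic ?char_poly_monic ?monicXn // => /eqP Ej.
have := size_char_poly M; rewrite Ej size_polyXn => -[jn].
have := char_poly_trace M (ltn0Sn n); rewrite Ej jn coefXn ltn_eqF //=.
by move/esym/eqP; rewrite oppr_eq0 => /eqP.
Qed.

Lemma mderiv_expS (K : comNzRingType) n (q : {mpoly K[n]}) s k :
  (q ^+ k.+1)^`M(s) = (q ^+ k * q^`M(s)) *+ k.+1.
Proof.
elim: k => [|k IH]; first by rewrite expr1 expr0 mul1r.
by rewrite exprS mderivM IH mulrnAr mulrA -exprS [q^`M(s) * _]mulrC -mulrS.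
Qed.

Section VanishingOfJacobian.
Variables (K : fieldType) (n : nat) (P : {mpoly K[n]}).
Hypothesis two_neq0 : 2%:R != 0 :> K.
Hypothesis P2 : order_ge 2 P.
Hypothesis nilP : hessian_nilpotent P.

Local Notation t := (tX K n).

Definition gradH : 'I_n.+1 -> {mpoly K[n.+1]} :=
  text (fun i => t * mwiden P^`M(i)) 0.

Lemma gradHE i : 'X_i - gradH i = text (gradt P) t i.
Proof. by elim/text_ind: i => [i|]; rewrite /gradH ?textz ?textt ?subr0. Qed.

Lemma order_ge_mwiden a (p : {mpoly K[n]}) : order_ge a p -> order_ge a (mwiden p).
Proof.
move=> hp; rewrite mwiden_psub -[a]muln1; apply: degrel_leq_psub hp => i.
by apply: degrelX; rewrite /= mdeg1.
Qed.

Lemma order_gradH i : order_ge 2 (gradH i).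
Proof.
elim/text_ind: i => [i|]; rewrite /gradH ?textz ?textt; last exact: degrel0.
apply: (@order_geM _ _ 1 1); first by apply: degrelX; rewrite /= mdeg1.
exact/order_ge_mwiden/order_ge_deriv.
Qed.

(** For [A] the Hessian of [P], [1 - t A] divides [1 - (t A)^k = 1]. Its determinant is thus a unit,
    hence constant, and equals 1 at the origin. *)
Lemma keller_gradH : \det (jacobian (fun i => 'X_i - gradH i)) = 1.
Proof.
rewrite (funext gradHE) det_jacobian_text.
pose A := map_mx (@mwiden n K) (hessian P).
have -> : zjacobian (gradt P) = 1%:M - t *: A.
  apply/matrixP=> i j; rewrite !mxE mderivB mderivXU eq_zvar mderivM mderiv_t_z.
  by rewrite mul0r add0r mderiv_mwiden_z.
have [k Ak] : exists k, A ^+ k = 0.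
  by case: nilP => k hk; exists k; rewrite /A -rmorphXn /= hk map_mx0.
have tAk : (t *: A) ^+ k = 0.
  have E e : (t *: A) ^+ e = t ^+ e *: A ^+ e.
    elim: e => [|e IH]; first by rewrite !expr0 scale1r.
    by rewrite !exprS IH -!mulmxE -scalemxAl -scalemxAr scalerA.
  by rewrite E Ak scaler0.
have /(congr1 determinant) := subrXX_comm k (commr_sym (commr1 (t *: A))).
rewrite expr1n tAk subr0 -mulmxE det_mulmx det1 mulrC => /esym h.
apply: (mpoly_unit1 h); rewrite -det_map_mx raddfB /= map_mx1.
suff -> : map_mx (mcoeff 0%MM) (t *: A) = 0 by rewrite subr0 det1.
apply/matrixP=> i j; rewrite !mxE rmorphM /= mcoeffX.
by rewrite mnm1_eq0 mul0r.
Qed.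

Section Inverse.
Variable G : 'I_n.+1 -> {mpoly K[n.+1]}.
Hypothesis FG : forall i, psub G (text (gradt P) t i) = 'X_i.
Hypothesis GF : forall i, psub (text (gradt P) t) (G i) = 'X_i.

Definition invN i := psub G (mwiden P^`M(i)).

Lemma inv_t : G (tvar n) = t.
Proof. by rewrite -[RHS]FG textt psubX. Qed.

Lemma inv_z i : G (zvar i) = 'X_(zvar i) + t * invN i.
Proof.
have := FG (zvar i); rewrite textz /gradt raddfB /= rmorphM /= !psubX inv_t => <-.
by rewrite subrK.
Qed.

(** Since [grad P] has no constant term, [(z - t grad P, t)] fixes all points [(0, t)], and so does
    its inverse. Restriction to [z = 0] is [psub o], which changes a polynomial only by terms of
    positive order in [z]. *)
Lemma zorder_inv_z i : zorder_ge 1 (G (zvar i)).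
Proof.
pose o := text (fun=> 0) t : 'I_n.+1 -> {mpoly K[n.+1]}.
have sub_o q : zorder_ge 1 (q - psub o q).
  rewrite -[X in X - _]psub_id; apply: degrel_psub_congr.
  elim/text_ind => [j|]; rewrite /o ?textz ?textt.
    by rewrite subr0; apply: zorder_geX.
  by rewrite subrr; apply: degrel0.
suff o0 : psub o (G (zvar i)) = 0 by rewrite -[G _]subr0 -o0; apply: sub_o.
transitivity (psub o (psub (text (gradt P) t) (G (zvar i)))); last first.
  by rewrite GF psubX /o textz.
rewrite psub_psub; apply: psub_ext; elim/text_ind => [j|].
  rewrite !textz /gradt raddfB /= rmorphM /= !psubX /o textz textt sub0r psub_mwiden.
  have -> : psub (fun i => text (fun=> 0) t (zvar i)) P^`M(j) = 0;
    last by rewrite mulr0 oppr0.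
  have : order_ge 1 P^`M(j) by apply: order_ge_deriv.
  rewrite /psub /mmap => hP; rewrite big_seq big1 // => m m_p.
  have [l nz_l] := mnm_gt0P (hP m m_p).
  by rewrite /mmap1 (bigD1 l) //= textz expr0n (negbTE nz_l) mul0r mulr0.
by rewrite textt psubX.
Qed.

(* Since [G = z + t N], differentiating this Legendre transform gives directly
   [grad_z Q = N] and [dQ/dt = |N|^2 / 2]; no Poincare lemma is needed. *)
Definition invQ := psub G (mwiden P) - 2^-1 *: (t * \sum_i invN i ^+ 2).

(** The derivative of [P(G)] is the product of [N] with [dG = dz + N dt + t dN], and its term
    [t N . dN] cancels against the one from [t |N|^2 / 2]. A general [s] treats [z] and [t] at
    once. *)
Lemma mderiv_invQ s : invQ^`M(s) =
  \sum_i invN i * ('X_(zvar i))^`M(s) + 2^-1 *: (t^`M(s) * \sum_i invN i ^+ 2).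
Proof.
rewrite /invQ mderivB mderivZ mderiv_psub_z mderiv_mwiden_t raddf0 mul0r addr0.
pose S1 := \sum_i invN i * ('X_(zvar i))^`M(s).
pose S2 := \sum_i invN i ^+ 2.
pose S3 := \sum_i invN i * (invN i)^`M(s).
have -> : \sum_(i < n) psub G (mwiden P)^`M(zvar i) * (G (zvar i))^`M(s) =
    S1 + t^`M(s) * S2 + t * S3.
  rewrite /S1 /S2 /S3 !mulr_sumr -!big_split; apply: eq_bigr => i _ /=.
  rewrite mderiv_mwiden_z -/(invN i) inv_z mderivD mderivM; ring.
have -> : (t * \sum_i invN i ^+ 2)^`M(s) = t^`M(s) * S2 + t * (S3 + S3).
  rewrite mderivM; congr (_ + _ * _); rewrite raddf_sum /S3 -big_split /=.
  by apply: eq_bigr => i _; rewrite expr2 mderivM [_^`M(s) * _]mulrC.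
rewrite -/S1 -/S2 -!mul_mpolyC; set h := _%:MP.
have h2 : h + h = 1.
  rewrite /h -mpolyCD -[2^-1]mul1r -mulrDl -mpolyC1; congr (_%:MP).
  by rewrite -[1 + 1]/2%:R mulfV.
set u := t^`M(s) * S2; set v := t * S3.
have -> : t * (S3 + S3) = v + v by rewrite mulrDr.
have -> : S1 + u + v - h * (u + (v + v)) = S1 + h * u + (1 - (h + h)) * (u + v).
  by ring.
by rewrite h2 subrr mul0r addr0.
Qed.

Lemma mderiv_invQ_z j : invQ^`M(zvar j) = invN j.
Proof.
rewrite mderiv_invQ mderiv_t_z mul0r scaler0 addr0 (bigD1 j) //= mderivXU eqxx.
rewrite mulr1 big1 ?addr0 // => i ne_ij.
by rewrite mderivXU eq_zvar (negbTE ne_ij) mulr0.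
Qed.

Lemma mderiv_invQ_t : invQ^`M(tvar n) = 2^-1 *: \sum_i invN i ^+ 2.
Proof.
rewrite mderiv_invQ mderiv_t_t mul1r big1 ?add0r // => i _.
by rewrite mderivXU eq_zvar_tvar mulr0.
Qed.

(* The Jacobian of [N] is [A (1 - t A)^-1] for [A] the Hessian of [P] at [G]. *)
Lemma divergence_invN : \sum_i (invN i)^`M(zvar i) = 0.
Proof.
pose A := map_mx (psub G \o @mwiden n K) (hessian P).
pose J := zjacobian invN; pose U := 1%:M + t *: J; pose V := 1%:M - t *: A.
have JE : J = A *m U.
  apply/matrixP=> i j; rewrite !mxE mderiv_psub_z mderiv_mwiden_t raddf0 mul0r.
  rewrite addr0; apply: eq_bigr => k _.
  rewrite !mxE mderiv_mwiden_z inv_z mderivD mderivM mderivXU eq_zvar mderiv_t_z.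
  by rewrite mul0r add0r.
have VU : V *m U = 1%:M.
  by rewrite mulmxBl mul1mx -scalemxAl -JE addrK.
have UV := mulmx1C VU.
have VA : V *m A = A *m V.
  by rewrite mulmxBl mulmxBr mul1mx mulmx1 -scalemxAl -scalemxAr.
(* [U] is the inverse of [V = 1 - t A], so it commutes with [A]; hence [J^k = A^k U^k = 0]. *)
have UA : U *m A = A *m U.
  by rewrite -[LHS]mulmx1 -VU -!mulmxA [in LHS](mulmxA A) -VA !mulmxA UV mul1mx.
have [k Ak] : exists k, A ^+ k = 0.
  by case: nilP => k hk; exists k; rewrite /A -rmorphXn /= hk map_mx0.
have : \tr J = 0.
  apply: (@mxtrace_nilpotent _ _ _ k); rewrite JE mulmxE exprMn_comm.
    by rewrite Ak mul0r.
  by rewrite /GRing.comm -!mulmxE UA.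
by move=> E; rewrite -[RHS]E; apply: eq_bigr => i _; rewrite mxE.
Qed.

Definition zlaplacian (q : {mpoly K[n.+1]}) := \sum_(i < n) q^`M(zvar i)^`M(zvar i).

Lemma zlaplacianMn q a : zlaplacian (q *+ a) = zlaplacian q *+ a.
Proof.
by rewrite /zlaplacian -sumrMnl; apply: eq_bigr => i _; rewrite !mderivMn.
Qed.

Lemma zlaplacian_mderiv q s : zlaplacian q^`M(s) = (zlaplacian q)^`M(s).
Proof.
rewrite /zlaplacian raddf_sum; apply: eq_bigr => i _ /=.
by rewrite (mderiv_comm s) (mderiv_comm s).
Qed.

(** As [div N = 0], the left side is [(m+1) m Q^(m-1) |N|^2], where [|N|^2 = 2 dQ/dt]; for [m = 0]
    both sides are 0. *)
Lemma heat_invQ m :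
  zlaplacian (invQ ^+ m.+1) = (invQ ^+ m)^`M(tvar n) *+ (2 * m.+1).
Proof.
rewrite /zlaplacian.
under eq_bigr => i _ do
  rewrite mderiv_expS mderivMn mderivM mderiv_invQ_z mulrnDl.
rewrite big_split /= !sumrMnl -mulr_sumr divergence_invN mulr0 mul0rn addr0.
rewrite mulrnA; congr (_ *+ _); case: m => [|m].
  by rewrite expr0 -mpolyC1 mderivC mul0rn big1 // => i _; rewrite mderivC mul0r.
under eq_bigr => i _ do rewrite mderiv_expS mderiv_invQ_z mulrnAl -mulrA -expr2.
rewrite sumrMnl -mulr_sumr mderiv_expS mderiv_invQ_t -mulrnA mulnC mulrnA.
congr (_ *+ _); rewrite -scalerAr scalerMnl -mulr_natr mulVf //.
by rewrite scale1r.
Qed.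

(** [Delta_z] commutes with [d/dt], so each use of [heat_invQ] trades a Laplacian and a power of [Q]
    for a [t]-derivative. The factor is [2^k (k+1)!]; its existence suffices. *)
Lemma iter_heat_invQ k : exists a,
  iter k zlaplacian (invQ ^+ k.+1) = iter k (mderiv (tvar n)) invQ *+ a.
Proof.
elim: k => [|k [a IH]]; first by exists 1%N; rewrite expr1 mulr1n.
have iterMn q b : iter k zlaplacian (q *+ b) = iter k zlaplacian q *+ b.
  by elim: (k) => //= l ->; rewrite zlaplacianMn.
have iter_mderiv q s : iter k zlaplacian q^`M(s) = (iter k zlaplacian q)^`M(s).
  by elim: (k) => //= l ->; rewrite zlaplacian_mderiv.
exists (a * (2 * k.+2))%N; rewrite iterSr heat_invQ iterMn iter_mderiv IH.
by rewrite mderivMn -!mulrnA.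
Qed.

Lemma iter_mderiv_eq0 (q : {mpoly K[n.+1]}) s k :
  (msize q <= k)%N -> iter k (mderiv s) q = 0.
Proof.
move=> q_k; rewrite -mderivn_iter; apply/mpolyP=> m.
rewrite mcoeff_mderivm mcoeff0 [q@__]memN_msupp_eq0 ?mul0rn //.
apply: msize_mdeg_ge; rewrite (leq_trans q_k) // mdegD mdegMn mdeg1 mul1n.
by rewrite leq_addr ?leq_addl.
Qed.

Lemma evt_invQ : evt 0 invQ = P.
Proof.
rewrite /invQ /evt raddfB /= psubZ rmorphM /= -/(evt 0 t) evtt mpolyC0 mul0r.
rewrite scaler0 subr0 psub_mwiden psub_psub -[RHS]psub_id; apply: psub_ext => i.
rewrite inv_z raddfD /= rmorphM /= -!/(evt 0 _) evtz evtt mpolyC0 mul0r.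
by rewrite addr0.
Qed.

Lemma evt_zlaplacian q : evt 0 (zlaplacian q) = laplacian (evt 0 q).
Proof.
rewrite /laplacian /zlaplacian /evt raddf_sum; apply: eq_bigr => i _ /=.
by rewrite -!/(evt 0 _) !mderiv_evt.
Qed.

Lemma laplacian_vanishing k :
  (msize invQ <= k)%N -> iter k (@laplacian K n) (P ^+ k.+1) = 0.
Proof.
move=> hk; have [a E] := iter_heat_invQ k.
rewrite -{1}evt_invQ /evt -rmorphXn /= -/(evt 0 _).
have -> : forall q, iter k (@laplacian K n) (evt 0 q) = evt 0 (iter k zlaplacian q).
  by move=> q; elim: (k) => //= l ->; rewrite evt_zlaplacian.
by rewrite E iter_mderiv_eq0 // mul0rn /evt raddf0.
Qed.

Lemma zorder_invQ : zorder_ge 2 invQ.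
Proof.
have N1 i : zorder_ge 1 (invN i).
  rewrite /invN psub_mwiden; apply: zorder_ge_psub => [j|].
    exact: zorder_inv_z.
  exact: order_ge_deriv.
apply: degrelB.
  by rewrite psub_mwiden; apply: zorder_ge_psub => // j; apply: zorder_inv_z.
apply/degrelZ; rewrite -[2%N]add0n; apply: zorder_geM; first by [].
by apply: degrel_sum => i _; rewrite expr2; apply: (@zorder_geM _ _ 1 1).
Qed.

Lemma vanishing_of_inverse : vanishing_property P.
Proof.
split; last by exists (msize invQ) => k; apply: laplacian_vanishing.
exists (fps_of_mpoly invQ); split; last by exists invQ.
apply/(deformed_inversion_pair_mpoly P2 zorder_invQ); split=> i.
  rewrite -[RHS]FG textz; apply: psub_ext; elim/text_ind => [j|].
    by rewrite textz mderiv_invQ_z inv_z.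
  by rewrite textt inv_t.
by rewrite mderiv_invQ_z -inv_z GF.
Qed.

End Inverse.

Lemma vanishing_of_jacobian :
  (forall H : 'I_n.+1 -> {mpoly K[n.+1]}, (forall i, order_ge 2 (H i)) ->
     \det (jacobian (fun i => 'X_i - H i)) = 1 -> pinv (fun i => 'X_i - H i)) ->
  vanishing_property P.
Proof.
move=> /(_ gradH order_gradH keller_gradH); rewrite (funext gradHE).
by case=> G [FG GF]; apply: vanishing_of_inverse FG GF.
Qed.

End VanishingOfJacobian.

(** * The implications over the complex numbers *)

Section Equivalence.
Variable R : realType.
Local Notation C := R[i].

(** Assuming [P != 0] lets this serve statement (3) too, where the degree is exact; for [P = 0] the
    gradient map is the identity. *)
Lemma jacobian_of_quartic :
  (forall n (P : {mpoly C[n]}), (1 <= n)%N -> P != 0 -> P \is 4.-homog ->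
     hessian_nilpotent P -> vanishing_property P) ->
  forall n (H : 'I_n -> {mpoly C[n]}), (1 <= n)%N ->
    (forall i, fps_order_ge 2 (fps_of_mpoly (H i))) ->
    \det (jacobian (fun i => 'X_i - H i)) = 1 ->
    exists G : 'I_n -> fps C n,
      formal_inverse (fun i => fps_of_mpoly ('X_i - H i)) G /\
      (forall i, fps_polynomial (G i)).
Proof.
move=> quartic n H _ H2 kH.
have JC : JCcubic C.
  apply: (@cubic_of_symmetric _ 'i%C); [exact: sqr_i | by rewrite pnatr_eq0 |].
  move=> m P m_gt0 [P_lo P_hi] nilP; have [->|P_neq0] := eqVneq P 0.
    apply: (@pinv_ext _ _ (fun i => 'X_i)) => [i|]; first by rewrite raddf0 subr0.
    by exists (fun i => 'X_i); split=> i; rewrite psubX.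
  apply: vanishing_pinv; first exact: order_geW P_lo.
  apply: quartic => //; apply/dhomogP => l l_P.
  by apply/eqP; rewrite eqn_leq; apply/andP; split; [exact: P_hi | exact: P_lo].
pose d := \max_i msize (H i).
have [G FG] : pinv (fun i => 'X_i - H i).
  apply: (@JCdeg_of_cubic _ d JC) kH => i; split; first exact/order_geP.
  move=> m /msize_mdeg_lt /ltnW /leq_trans; apply; exact: leq_bigmax.
exists (fun i => fps_of_mpoly (G i)); split; last by move=> i; exists (G i).
apply/formal_inverse_mpoly => // i; rewrite mcoeffB mcoeffX mnm1_eq0.
by rewrite (@order_ge_mcoeff0 _ _ 2) ?subr0 //; apply/order_geP.
Qed.

(** [JC] is applied in [n + 1] variables, the last being [t], so [n] needs no lower bound. *)
Lemma vanishing_of_formal_jacobian :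
  (forall (n : nat) (H : 'I_n -> {mpoly C[n]}), (1 <= n)%N ->
     (forall i, fps_order_ge 2 (fps_of_mpoly (H i))) ->
     \det (jacobian (fun i => 'X_i - H i)) = 1 ->
     exists G : 'I_n -> fps C n,
       formal_inverse (fun i => fps_of_mpoly ('X_i - H i)) G /\
       (forall i, fps_polynomial (G i))) ->
  forall n (P : {mpoly C[n]}), order_ge 2 P -> hessian_nilpotent P ->
  vanishing_property P.
Proof.
move=> JC n P P2 nilP; apply: vanishing_of_jacobian => //.
  by rewrite pnatr_eq0.
move=> H H2 kH; have [|G [FG Gpoly]] := JC n.+1 H isT _ kH.
  by move=> i; apply/order_geP.
have [g gE] := choice Gpoly; have {}gE : G = fun i => fps_of_mpoly (g i).
  by apply/funext => i; apply/funext => m; rewrite gE.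
rewrite {}gE in FG; exists g; apply/formal_inverse_mpoly => // i.
rewrite mcoeffB mcoeffX mnm1_eq0 (@order_ge_mcoeff0 _ _ 2) ?subr0 //.
Qed.

End Equivalence.

Lemma order_ge_homog (K : fieldType) n d a (P : {mpoly K[n]}) :
  (a <= d)%N -> P \is d.-homog -> order_ge a P.
Proof. by move=> a_d /dhomogP hP m /hP ->. Qed.

Theorem theorem7p2 (R : realType) :
  [<-> (forall (n : nat) (P : {mpoly R[i][n]}), (1 <= n)%N ->
          P \is 4.-homog -> hessian_nilpotent P ->
          vanishing_property P);
       (forall (n d : nat) (P : {mpoly R[i][n]}), (1 <= n)%N -> (2 <= d)%N ->
          P \is d.-homog -> hessian_nilpotent P ->
          vanishing_property P);
       (forall (n d : nat) (P : {mpoly R[i][n]}), (1 <= n)%N -> (2 <= d)%N ->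
          msize P = d.+1 -> fps_order_ge 2 (fps_of_mpoly P) ->
          hessian_nilpotent P ->
          vanishing_property P);
       (forall (n : nat) (H : 'I_n -> {mpoly R[i][n]}), (1 <= n)%N ->
          (forall i, fps_order_ge 2 (fps_of_mpoly (H i))) ->
          \det (jacobian (fun i => 'X_i - H i)) = 1 ->
          exists G : 'I_n -> fps R[i] n,
            formal_inverse (fun i => fps_of_mpoly ('X_i - H i)) G /\
            (forall i, fps_polynomial (G i)))].
Proof.
tfae.
(* Statements (2) and (3) are both reached through the Jacobian conjecture. *)
- move=> h1; have JC := @jacobian_of_quartic R (fun n P n1 _ => h1 n P n1).
  move=> n d P _ d2 hP; apply: (vanishing_of_formal_jacobian JC).
  exact: order_ge_homog hP.
- move=> h2; have JC := @jacobian_of_quartic R (fun n P n1 _ => h2 n 4 P n1 isT).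
  move=> n d P _ _ _ /order_geP P2; exact: (vanishing_of_formal_jacobian JC).
- move=> h3; apply: jacobian_of_quartic => n P n1 P_neq0 hP.
  apply: (h3 n 4) => //; last exact/order_geP/(order_ge_homog _ hP).
  (* The leading monomial of a nonzero quartic form has degree 4, so [msize P = 5]. *)
  by rewrite -mlead_deg // (dhomog_mf hP) // mlead_supp.
- move=> JC n P _ hP; apply: (vanishing_of_formal_jacobian JC).
  exact: order_ge_homog hP.
Qed.
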